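(* (d-i) Every $4$-edge-connected graph with at most five $4$-cuts and with no $5$-cuts is $\mathbb{Z}_3$-connected. (d-ii) Every $5$-edge-connected graph with at most seven $5$-cuts is $\mathbb{Z}_3$-connected.
   Context: All graphs are finite, without loops, but parallel edges are allowed. For $\emptyset\neq A\subsetneq V(G)$, $\partial_G(A)$ is the set of edges with exactly one end in $A$. A $k$-cut is an edge cut $\partial_G(A)$ with exactly $k$ edges; counts of $k$-cuts count distinct such edge sets (trivial cuts isolating a single vertex included). A boundary function of $G$ is a map $\beta:V(G)\to\mathbb{Z}_3$ with $\sum_{x\in V(G)}\beta(x)=0$ in $\mathbb{Z}_3$. For such $\beta$, a $\beta$-orientation is an orientation $D$ of $G$ with $d^+_D(v)-d^-_D(v)\equiv\beta(v)\pmod 3$ for all $v$. $G$ is $\mathbb{Z}_3$-connected if it has a $\beta$-orientation for every boundary function $\beta$. *)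

(* Defs.v *)
From HB Require Import structures.
From mathcomp Require Import all_boot all_order all_algebra.
Set Implicit Arguments.
Unset Strict Implicit.
Unset Printing Implicit Defensive.
Import GRing.Theory.

(* Finite loopless multigraphs: [card_ends] excludes loops, and [ends] need
   not be injective, so parallel edges are allowed. *)
Record mgraph := MGraph {
  vertex : finType;
  edge : finType;
  ends : edge -> {set vertex};
  card_ends : forall e : edge, #|ends e| = 2
}.

Section MGraphDefs.
Variable G : mgraph.

Definition boundary (A : {set vertex G}) : {set edge G} :=
  [set e | #|ends e :&: A| == 1].

Definition cuts : {set {set edge G}} :=
  [set boundary A | A : {set vertex G} & (A != set0) && (A != setT)].

Definition kcuts (k : nat) : {set {set edge G}} :=
  [set C in cuts | #|C| == k].

Definition edge_connected (k : nat) : Prop :=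
  forall C : {set edge G}, C \in cuts -> k <= #|C|.

Definition boundary_function (beta : vertex G -> 'Z_3) : Prop :=
  (\sum_(x : vertex G) beta x = 0)%R.

(* [D e] is the pair (tail, head) chosen for the edge [e]; the two components
   are distinct because [#|ends e| = 2]. *)
Definition orientation (D : edge G -> vertex G * vertex G) : Prop :=
  forall e : edge G, ends e = [set (D e).1; (D e).2].

Definition outdeg (D : edge G -> vertex G * vertex G) (v : vertex G) : nat :=
  #|[set e | (D e).1 == v]|.

Definition indeg (D : edge G -> vertex G * vertex G) (v : vertex G) : nat :=
  #|[set e | (D e).2 == v]|.

Definition beta_orientation (beta : vertex G -> 'Z_3)
    (D : edge G -> vertex G * vertex G) : Prop :=
  orientation D /\
  forall v : vertex G, ((outdeg D v)%:R - (indeg D v)%:R = beta v)%R.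

Definition Z3_connected : Prop :=
  forall beta : vertex G -> 'Z_3, boundary_function beta ->
    exists D : edge G -> vertex G * vertex G, beta_orientation beta D.

End MGraphDefs.

(* Main.v *)
Require Import Defs.
From HB Require Import structures.
From mathcomp Require Import all_boot all_order all_algebra.
From mathcomp Require Import zify ring.
Set Implicit Arguments.
Unset Strict Implicit.
Unset Printing Implicit Defensive.
Import GRing.Theory.

(**
  The proof follows the partial-orientation method of Lovász, Thomassen, Wu and
  Zhang.  Besides the edges still to be oriented, a graph carries [p v] arcs
  from an extra vertex z0 to [v] and [q v] arcs from [v] to z0, whose
  directions are fixed.  Write n(A) for the number of edges (including these
  arcs) leaving A, and t(A) for the representative of the boundary of A
  modulo 3 of least absolute value having the parity of n(A).  If
  n(A) >= 4 + |t(A)| for all proper nonempty A avoiding z0 and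
  n(z0) <= 4 + |t(z0)|, an orientation with the prescribed boundary exists
  ([valid_solvable]).

  In a minimal counterexample, a set A with at least two vertices and
  n(A) < 6 + |t(A)| can be contracted, and its inside is then oriented with the
  contracted outside as z0; so every such set can afford to lose 2.  A vertex
  with n = 4 and t = 0 is split off.  Any other vertex tolerates the deletion
  of an outgoing arc or of an incoming one; an edge from a vertex of the first
  kind to one of the second is deleted, so up to reversal all vertices are of
  the first kind.  Then arcs into z0 can be deleted, whence z0 has at most five
  arcs, all outgoing.  Finally an edge xy is deleted as x -> y, and replaced by
  z0 -> y if z0 has at most four arcs, and by two arcs y -> z0 if it has five.

  For the theorem, take the inclusion-minimal sides of the 4-cuts
  (respectively 5-cuts).  By submodularity such a minimal side is contained in
  or disjoint from any other side, so there are few of them, and at most seven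
  arcs at z0, ending in the minimal sides, repair all the deficient cuts.
*)

(* [ok n z] says that n >= 4 + |t|, where t is the integer of least absolute
   value that is congruent to z modulo 3 and to n modulo 2; [up n z] says that
   n <= 4 + |t|. Accordingly [ok (n - 2) z] says that n >= 6 + |t|. *)
Definition ok (n : nat) (z : 'Z_3) : bool :=
  [|| 5 < n, (n == 5) && (z != 0%R) | (n == 4) && (z == 0%R)].

Definition up (n : nat) (z : 'Z_3) : bool :=
  [|| n <= 5, (n == 6) && (z != 0%R) | (n == 7) && (z == 0%R)].

Lemma Z3_cases (z : 'Z_3) : [\/ z = 0, z = 1 | z = -1]%R.
Proof.
case: z => [[|[|[|//]]] Hz]; [apply: Or31|apply: Or32|apply: Or33]; exact/val_inj.
Qed.

Ltac z3eval := repeat match goal with |- context [@eq_op ?T ?a ?b] =>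
   let r := eval vm_compute in (@eq_op T a b) in
   lazymatch r with
   | true => change (@eq_op T a b) with true
   | false => change (@eq_op T a b) with false end end.
Ltac z3 z := let e := fresh in case: (Z3_cases z) => e; rewrite ?e {e}.
Ltac z3lia := z3eval; rewrite ?andbT ?andbF ?orbF /=; lia.

(** * Edge lists and their orientations *)

Section EdgeLists.
Variable V : finType.
Implicit Types (es ds : seq (V * V)) (A W : {set V}) (b : V -> 'Z_3).
Implicit Types (p q : V -> nat).

Definition flip (e : V * V) := (e.2, e.1).

Definition orients es ds :=
  all2 (fun e d => (d == e) || (d == flip e)) es ds.

Definition outs ds v := \sum_(d <- ds) (d.1 == v).
Definition ins ds v := \sum_(d <- ds) (d.2 == v).
Definition net ds v : 'Z_3 := ((outs ds v)%:R - (ins ds v)%:R)%R.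
Definition cut es A := \sum_(e <- es) ((e.1 \in A) (+) (e.2 \in A)).

Definition inside W es := all (fun e => (e.1 \in W) && (e.2 \in W)) es.

Definition solvable W es b :=
  exists2 ds, orients es ds & forall v, v \in W -> net ds v = b v.

Lemma orients_refl es : orients es es.
Proof. by elim: es => //= e es ->; rewrite eqxx. Qed.

Lemma orients_cat es1 es2 ds1 ds2 :
  orients es1 ds1 -> orients es2 ds2 -> orients (es1 ++ es2) (ds1 ++ ds2).
Proof. by elim: es1 ds1 => [|e es IH] [|d ds] //= /andP[-> /IH h] /h. Qed.

Lemma orients_size es ds : orients es ds -> size ds = size es.
Proof. by elim: es ds => [|e es IH] [|d ds] //= /andP[_ /IH ->]. Qed.

Lemma orients_catP es1 es2 ds : orients (es1 ++ es2) ds ->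
  exists ds1 ds2, [/\ ds = ds1 ++ ds2, orients es1 ds1 & orients es2 ds2].
Proof.
elim: es1 ds => [|e es IH] ds /= h; first by exists [::], ds.
case: ds h => // d ds /andP[h /IH[ds1 [ds2 [-> h1 h2]]]].
by exists (d :: ds1), ds2; split=> //=; rewrite h.
Qed.

Lemma orients_perm es es' ds : perm_eq es es' -> orients es ds ->
  exists2 ds', orients es' ds' & perm_eq ds ds'.
Proof.
elim: es es' ds => [|e es IH] es' ds.
  by rewrite perm_sym => /perm_nilP ->; case: ds => // _; exists [::].
move=> pe; have ein : e \in es' by rewrite -(perm_mem pe) mem_head.
case/splitPr: ein pe => s1 s2; rewrite perm_sym perm_catC /= perm_cons perm_catC.
rewrite perm_sym => pe; case: ds => //= d ds /andP[hd /(IH _ _ pe)[ds'] o pd].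
have [d1 [d2 [E o1 o2]]] := orients_catP o.
exists (d1 ++ d :: d2); first by apply: orients_cat => //=; rewrite hd.
by rewrite perm_sym perm_catC /= perm_cons perm_catC -E perm_sym.
Qed.

Lemma orients_map (c : V -> V) es ds' :
  orients [seq (c e.1, c e.2) | e <- es] ds' ->
  exists2 ds, orients es ds & ds' = [seq (c d.1, c d.2) | d <- ds].
Proof.
elim: es ds' => [|e es IH] [|d ds'] //=; first by exists [::].
case/andP=> h /IH[ds o ->]; case/orP: h => /eqP ->.
  by exists (e :: ds) => //=; rewrite eqxx.
by exists (flip e :: ds) => //=; rewrite eqxx orbT.
Qed.

Lemma outs_cons d ds v : outs (d :: ds) v = (d.1 == v) + outs ds v.
Proof. by rewrite /outs big_cons. Qed.
Lemma ins_cons d ds v : ins (d :: ds) v = (d.2 == v) + ins ds v.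
Proof. by rewrite /ins big_cons. Qed.
Lemma net_cons d ds v :
  net (d :: ds) v = ((d.1 == v)%:R - (d.2 == v)%:R + net ds v)%R.
Proof. by rewrite /net outs_cons ins_cons !natrD; ring. Qed.
Lemma net_cat ds1 ds2 v : net (ds1 ++ ds2) v = (net ds1 v + net ds2 v)%R.
Proof. by rewrite /net /outs /ins !big_cat !natrD /=; ring. Qed.
Lemma net_perm ds1 ds2 v : perm_eq ds1 ds2 -> net ds1 v = net ds2 v.
Proof. by move=> h; rewrite /net /outs /ins !(perm_big _ h). Qed.
Lemma cut_cons e es A : cut (e :: es) A = ((e.1 \in A) (+) (e.2 \in A)) + cut es A.
Proof. by rewrite /cut big_cons. Qed.
Lemma cut_cat es1 es2 A : cut (es1 ++ es2) A = cut es1 A + cut es2 A.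
Proof. by rewrite /cut big_cat. Qed.
Lemma cut_perm es1 es2 A : perm_eq es1 es2 -> cut es1 A = cut es2 A.
Proof. by move=> h; rewrite /cut (perm_big _ h). Qed.
Lemma cut_orients es ds A : orients es ds -> cut ds A = cut es A.
Proof.
elim: es ds => [|e es IH] [|d ds] //= /andP[h /IH E]; rewrite !cut_cons E.
by case/orP: h => /eqP -> //=; rewrite addbC.
Qed.
Lemma inside_orients W es ds : orients es ds -> inside W es -> inside W ds.
Proof.
elim: es ds => [|e es IH] [|d ds] //= /andP[h /IH E] /andP[h1 /E ->].
by rewrite andbT; case/orP: h => /eqP -> //=; rewrite andbC.
Qed.

Lemma sum_mem1 A (x : V) : \sum_(v in A) (x == v) = (x \in A).
Proof.
case xA: (x \in A).
  rewrite (bigD1 x) //= eqxx big1 // => v /andP[_ /negbTE]; by rewrite eq_sym => ->.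
by rewrite big1 // => v vA; case: eqP => // E; rewrite E vA in xA.
Qed.

Lemma sum_outs ds A : \sum_(v in A) outs ds v = \sum_(d <- ds) (d.1 \in A).
Proof. by rewrite exchange_big; apply: eq_bigr => d _; rewrite sum_mem1. Qed.
Lemma sum_ins ds A : \sum_(v in A) ins ds v = \sum_(d <- ds) (d.2 \in A).
Proof. by rewrite exchange_big; apply: eq_bigr => d _; rewrite sum_mem1. Qed.

Lemma sum_net ds A : (\sum_(v in A) net ds v =
  (\sum_(d <- ds) (d.1 \in A))%:R - (\sum_(d <- ds) (d.2 \in A))%:R)%R.
Proof. by rewrite sumrB -!natr_sum sum_outs sum_ins. Qed.

Lemma sum_net_inside W ds : inside W ds -> (\sum_(v in W) net ds v = 0)%R.
Proof.
move=> h; rewrite sum_net [X in (X%:R - _)%R](_ : _ = \sum_(d <- ds) (d.2 \in W)).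
  by rewrite subrr.
by rewrite !big_seq; apply: eq_bigr => d /(allP h) /andP[-> ->].
Qed.

Lemma net_out W ds v : inside W ds -> v \notin W -> net ds v = 0%R.
Proof.
move=> h vW; rewrite /net /outs /ins !big_seq !big1 ?subrr //.
  by move=> d /(allP h) /andP[_ h2]; case: eqP => // E; rewrite -E h2 in vW.
by move=> d /(allP h) /andP[h2 _]; case: eqP => // E; rewrite -E h2 in vW.
Qed.

Lemma net_flip ds v : net (map flip ds) v = (- net ds v)%R.
Proof. by rewrite /net /outs /ins !big_map opprB. Qed.

Lemma solvable_opp W es b : solvable W es (fun v => - b v)%R -> solvable W es b.
Proof.
case=> ds o h; exists (map flip ds) => [|v vW]; last by rewrite net_flip h // opprK.
elim: es ds o {h} => [|e es IH] [|d ds] //= /andP[h /IH ->]; rewrite andbT.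
by case/orP: h => /eqP ->; rewrite /flip /= -?surjective_pairing eqxx ?orbT.
Qed.

(* [gperm es es'] : [es'] lists the same undirected edges as [es]. *)
Definition gperm es es' := exists2 m, orients es m & perm_eq m es'.

Lemma gperm_solvable W es es' b :
  gperm es es' -> solvable W es' b -> solvable W es b.
Proof.
case=> m o pm [ds o' h]; rewrite perm_sym in pm.
have [ds' o2 pd] := orients_perm pm o'.
exists ds'; last by move=> v /h <-; apply: net_perm; rewrite perm_sym.
elim: es m ds' o o2 {pm pd} => [|e es IH] [|f m] [|d ds'] //= /andP[h1 /IH h2].
case/andP=> h3 /h2 ->; rewrite andbT.
by case/orP: h1 h3 => /eqP -> /orP[] /eqP ->;
   rewrite /flip /= -?surjective_pairing eqxx ?orbT.
Qed.

Lemma gperm_cut es es' A : gperm es es' -> cut es' A = cut es A.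
Proof. by case=> m o pm; rewrite -(cut_perm _ pm) (cut_orients _ o). Qed.

Lemma gperm_inside W es es' : gperm es es' -> inside W es -> inside W es'.
Proof.
case=> m o pm /(inside_orients o); rewrite /inside => /allP h.
by apply/allP => e; rewrite -(perm_mem pm) => /h.
Qed.

Lemma gperm_size es es' : gperm es es' -> size es' = size es.
Proof. by case=> m o /perm_size <-; rewrite (orients_size o). Qed.

Lemma gperm_edge es e : e \in es -> gperm es (e :: rem e es).
Proof. by move=> h; exists es; [exact: orients_refl | exact: perm_to_rem]. Qed.

Lemma gperm_flip es e : e \in es -> gperm es (flip e :: rem e es).
Proof.
move=> h; have pe := perm_to_rem h; rewrite perm_sym in pe.
have o : orients (e :: rem e es) (flip e :: rem e es).
  by rewrite /= eqxx orbT orients_refl.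
have [m o1 pm] := orients_perm pe o.
by exists m; rewrite // perm_sym.
Qed.

Lemma cut_edge es A : 0 < cut es A ->
  exists x y es', [/\ gperm es ((x, y) :: es'), x \in A & y \notin A].
Proof.
move=> h; have /hasP[[x y] /= ein xe] : has (fun e => (e.1 \in A) (+) (e.2 \in A)) es.
  apply: contraLR h => /hasPn h; rewrite -leqNgt leqn0 /cut big_seq big1 // => e /h.
  by case: (_ (+) _).
case xA: (x \in A) xe => /=.
  move=> yA; exists x, y, (rem (x, y) es).
  by split=> //; exact: (gperm_edge ein).
move=> yA; exists y, x, (rem (x, y) es); split=> //; last by rewrite xA.
exact: (gperm_flip ein).
Qed.

(** Each edge at [x] is turned to start at [x]. A loop there would enter the star without being
    counted by the cut. *)
Lemma gperm_star es x : (x, x) \notin es -> exists ys rest,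
  [/\ gperm es (map (pair x) ys ++ rest), size ys = cut es [set x],
      all (fun y => y != x) ys & all (fun e => (e.1 != x) && (e.2 != x)) rest].
Proof.
move=> hx; pose m := [seq (if e.2 == x then flip e else e) | e <- es].
have om : orients es m.
  rewrite /m; elim: (es) => //= e s ->; rewrite andbT.
  by case: ifP; rewrite eqxx ?orbT.
pose a (e : V * V) := e.1 == x.
exists [seq e.2 | e <- m & a e], [seq e <- m | ~~ a e].
have -> : map (pair x) [seq e.2 | e <- m & a e] = [seq e <- m | a e].
  rewrite -map_comp -[RHS]map_id; apply/eq_in_map => -[u v].
  by rewrite mem_filter => /andP[/eqP /= ->].
split.
- by exists m => //; rewrite perm_sym perm_filterC.
- rewrite size_map size_filter /m count_map /cut -sumn_count sumnE big_map.
  rewrite big_seq [RHS]big_seq; apply: eq_bigr => -[u v] uv /=; rewrite !inE /a.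
  case: (v =P x) uv => [->|/eqP vx] uv /=; last by rewrite addbF.
  by rewrite eqxx addbT; case: eqP uv => //= ->; rewrite (negbTE hx).
- apply/allP => y /mapP[e]; rewrite mem_filter /a => /andP[e1 /mapP[[u v] uv E]] ->.
  move: e1; rewrite E /=; case: (v =P x) uv => [->|/eqP vx] uv _ //=.
  by apply: contraNneq hx => ux; rewrite -{1}ux.
apply/allP => e; rewrite mem_filter /a => /andP[e1 /mapP[[u v] uv E]].
rewrite e1 /=; move: e1; rewrite E /=.
by case: (v =P x) => [->|/eqP vx _] /=; first by rewrite eqxx.
Qed.
End EdgeLists.

(** * Contraction of tight sets *)

Section PartialOrientation.
Variable V : finType.
Implicit Types (es ds : seq (V * V)) (A W : {set V}) (b : V -> 'Z_3).
Implicit Types (p q : V -> nat).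

(* [p v] arcs go from z0 to [v] and [q v] arcs from [v] to z0; [b] is the
   boundary prescribed for the undirected edges alone. *)
Definition deg es p q A := cut es A + \sum_(v in A) (p v + q v).
Definition bnd b p q A : 'Z_3 := (\sum_(v in A) (b v - (p v)%:R + (q v)%:R))%R.

Record valid W es b p q : Prop := Valid {
  valid_in : inside W es;
  valid_sum : (\sum_(v in W) b v = 0)%R;
  valid_up : up (\sum_(v in W) (p v + q v)) (bnd b p q W);
  valid_ok : forall A, A != set0 -> A \proper W ->
    ok (deg es p q A) (bnd b p q A) }.

(* The factor 8 lets the number of arcs at z0, which is at most 7, change freely
   whenever an edge or a vertex disappears. *)
Definition meas W es p q := 8 * (#|W| + size es) + \sum_(v in W) (p v + q v).

Definition solves m := forall W es b p q,
  valid W es b p q -> meas W es p q < m -> solvable W es b.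

Definition outer A es := [seq e <- es | ~~ ((e.1 \in A) && (e.2 \in A))].

Lemma sum_fiber (R : Type) (idx : R) (op : Monoid.com_law idx) W A
    (c : V -> V) (f : V -> R) :
  \big[op/idx]_(v in A) \big[op/idx]_(u in W | c u == v) f u =
  \big[op/idx]_(u in [set u in W | c u \in A]) f u.
Proof.
rewrite [RHS](partition_big c (mem A)) => [|u]; last by rewrite inE => /andP[].
apply: eq_bigr => v vA; apply: eq_bigl => u; rewrite inE.
by case: (c u =P v) => [->|_]; rewrite ?andbF // vA !andbT.
Qed.

(** Contracting [A] to its point [a] turns the sets of the new graph into their preimages under [c],
    which have the same degree and boundary; hence validity is inherited. The measure falls because
    a second point of [A] disappears. *)
Lemma contract_solvable W es b p q A :
  solves (meas W es p q) -> valid W es b p q -> A \proper W -> 1 < #|A| ->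
  exists2 ds, orients (outer A es) ds &
    forall v, v \in W :\: A -> net ds v = b v.
Proof.
move=> IH [hin hsum hup hok] AW A1.
have AsW := proper_sub AW.
have [a aA] : exists a, a \in A by apply/set0Pn; rewrite -card_gt0 ltnW.
have [a2 a2A a2a] : exists2 a2, a2 \in A & a2 != a.
  by have := A1; rewrite (cardsD1 a) aA ltnS card_gt0 => /set0Pn[a2];
     rewrite !inE => /andP[? ?]; exists a2.
pose c v := if v \in A then a else v.
have cW v : v \in W -> c v \in W by rewrite /c; case: ifP => // _ _; exact: (subsetP AsW).
pose W1 := c @: W.
pose pre A1 := [set u in W | c u \in A1].
pose es1 := [seq (c e.1, c e.2) | e <- outer A es].
pose b1 v := (\sum_(u in W | c u == v) b u)%R.
pose p1 v := \sum_(u in W | c u == v) p u.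
pose q1 v := \sum_(u in W | c u == v) q u.
have preW1 : pre W1 = W.
  by apply/setP => u; rewrite inE; case uW: (u \in W) => //=; exact: imset_f.
have Epq A1' : \sum_(v in A1') (p1 v + q1 v) = \sum_(v in pre A1') (p v + q v).
  by rewrite !big_split /= /p1 /q1 !(sum_fiber _ W A1' c).
have Eb A1' : bnd b1 p1 q1 A1' = bnd b p q (pre A1').
  rewrite /bnd -(sum_fiber _ W A1' c); apply: eq_bigr => v _.
  by rewrite !natr_sum -sumrB -big_split.
have Ec A1' : cut es1 A1' = cut es (pre A1').
  rewrite /cut /es1 big_map /outer big_filter big_mkcond /= big_seq [RHS]big_seq.
  apply: eq_bigr => e /(allP hin) /andP[e1 e2]; rewrite !inE e1 e2 /= /c.
  by case: (e.1 \in A); case: (e.2 \in A) => //=; rewrite addbb.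
have v1 : valid W1 es1 b1 p1 q1.
  split.
  - rewrite /inside all_map; apply/allP => e; rewrite mem_filter => /andP[_].
    by move=> /(allP hin) /andP[e1 e2] /=; rewrite !imset_f.
  - by rewrite /b1 (sum_fiber _ W W1 c) -/(pre W1) preW1.
  - by rewrite Epq Eb preW1.
  - move=> A1' A0 AP; rewrite /deg Ec Epq Eb; apply: hok.
      case/set0Pn: A0 => v vA; have := subsetP (proper_sub AP) _ vA.
      by case/imsetP=> u uW E; apply/set0Pn; exists u; rewrite inE uW -E.
    rewrite properE; apply/andP; split; first by apply/subsetP => u; rewrite inE => /andP[].
    case/properP: AP => _ [v /imsetP[u uW ->] h]; apply/subsetPn; exists u => //.
    by rewrite inE (negbTE h) andbF.
have m1 : meas W1 es1 p1 q1 < meas W es p q.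
  rewrite /meas Epq preW1 ltn_add2r ltn_pmul2l // -addSn.
  apply: leq_add; last by rewrite size_map size_filter count_size.
  apply: proper_card; rewrite properE; apply/andP; split.
    by apply/subsetP => v /imsetP[u uW ->]; exact: cW.
  apply/subsetPn; exists a2; first exact: (subsetP AsW).
  apply/imsetP => -[u uW]; rewrite /c; case: ifP => [_ E|uA E].
    by rewrite E eqxx in a2a.
  by rewrite -E a2A in uA.
have [ds1 o h] := IH _ _ _ _ _ v1 m1.
have [ds o' E] := orients_map o.
exists ds => // v; rewrite inE => /andP[vA vW].
have cv u : (c u == v) = (u == v).
  by rewrite /c; case: ifP => // uA; apply/eqP/eqP => E'; rewrite -E' ?aA ?uA in vA.
have vW1 : v \in W1 by apply/imsetP; exists v => //; apply/esym/eqP; rewrite cv.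
have <- : net ds1 v = net ds v.
  by rewrite E /net /outs /ins !big_map; congr (_%:R - _%:R)%R;
     apply: eq_bigr => d _ /=; rewrite cv.
rewrite h // /b1 (eq_bigl (pred1 v)) ?big_pred1_eq // => u.
by rewrite cv /= andbC; case: eqP => //= ->.
Qed.

(** Since n and t have the same parity, n < 6 + |t| already means n <= 4 + |t|. This is the bound
    needed at z0 when a tight set becomes the whole vertex set. *)
Lemma okN2_up n z : ok n z -> ~~ ok (n - 2) z -> up n z.
Proof. rewrite /ok /up; z3 z; z3lia. Qed.

Lemma up_le7 n z : up n z -> n <= 7.
Proof. rewrite /up; z3 z; z3lia. Qed.

Lemma upN n z : up n (- z)%R = up n z.
Proof. by rewrite /up oppr_eq0. Qed.

Lemma okN n z : ok n (- z)%R = ok n z.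
Proof. by rewrite /ok oppr_eq0. Qed.

(** The oriented edges leaving [A] turn into arcs at z0, and their contribution is subtracted from
    [b]. Subsets of [A] thus keep degree and boundary, and tightness supplies the bound at z0. *)
Lemma tight_solvable W es b p q A :
  solves (meas W es p q) -> valid W es b p q -> A \proper W -> 1 < #|A| ->
  ~~ ok (deg es p q A - 2) (bnd b p q A) -> solvable W es b.
Proof.
move=> IH hv AW A1 hA.
have [ds o hds] := contract_solvable IH hv AW A1.
case: hv => hin hsum hup hok.
have AsW := proper_sub AW.
have A0 : A != set0 by rewrite -card_gt0 ltnW.
pose inn := [seq e <- es | (e.1 \in A) && (e.2 \in A)].
have pes : perm_eq (inn ++ outer A es) es by exact/permPl/perm_filterC.
pose b2 v := (b v - net ds v)%R.
pose p2 v := p v + ins ds v.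
pose q2 v := q v + outs ds v.
have dsW : inside W ds.
  apply: (inside_orients o); apply/allP => e.
  by rewrite mem_filter => /andP[_ /(allP hin)].
have out_ds A' : A' \subset A ->
    \sum_(v in A') (p2 v + q2 v) = \sum_(v in A') (p v + q v) + cut (outer A es) A'.
  move=> A'A; rewrite -(cut_orients _ o) /p2 /q2 !big_split /= sum_outs sum_ins.
  suff -> : cut ds A' = \sum_(d <- ds) (d.1 \in A') + \sum_(d <- ds) (d.2 \in A') by lia.
  rewrite /cut -big_split /=.
  have h : all (fun d => ~~ ((d.1 \in A) && (d.2 \in A))) ds.
    have := filter_all (fun e => ~~ ((e.1 \in A) && (e.2 \in A))) es.
    rewrite -/(outer A es); elim: (outer A es) (ds) o => [|e s IHs] [|d ds'] //=.
    case/andP=> hd /IHs IHo /andP[he /IHo ->]; rewrite andbT.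
    by case/orP: hd => /eqP -> //=; rewrite andbC.
  rewrite !big_seq; apply: eq_bigr => d /(allP h).
  have s1 := subsetP A'A d.1; have s2 := subsetP A'A d.2.
  case: (d.1 \in A') s1 => s1; case: (d.2 \in A') s2 => s2 //=.
  by rewrite s1 ?s2.
have bndE A' : bnd b2 p2 q2 A' = bnd b p q A'.
  by apply: eq_bigr => v _; rewrite /b2 /p2 /q2 /net !natrD; ring.
(* Both [b] and [net ds] sum to zero over [W] and agree off [A], so their sums over [A] agree as
   well. *)
have sum2 : (\sum_(v in A) b2 v = 0)%R.
  have split (f : V -> 'Z_3) : (\sum_(v in W) f v = 0 ->
      \sum_(v in A) f v = - \sum_(v in W :\: A) f v)%R.
    by rewrite (big_setID A) /= (setIidPr AsW) => /eqP; rewrite addr_eq0 => /eqP.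
  rewrite sumrB (split _ (sum_net_inside dsW)) (split _ hsum).
  by rewrite (eq_bigr _ hds) subrr.
have degE A' : A' \subset A -> deg inn p2 q2 A' = deg es p q A'.
  move=> h; rewrite /deg out_ds // -(cut_perm _ pes) cut_cat; lia.
have cutA : cut inn A = 0.
  rewrite /cut big_filter big1 // => e /andP[-> ->] //.
have hv2 : valid A inn b2 p2 q2.
  split=> //.
  - exact: filter_all.
  - rewrite bndE; have := degE A (subxx _); rewrite {1}/deg cutA add0n => ->.
    exact: okN2_up (hok _ A0 AW) hA.
  - move=> A' A'0 A'A; rewrite degE ?proper_sub // bndE; apply: hok => //.
    exact: proper_trans A'A AW.
have m2 : meas A inn p2 q2 < meas W es p q.
  have := degE A (subxx _); rewrite {1}/deg cutA add0n /meas => E.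
  have := proper_card AW; have := up_le7 (okN2_up (hok _ A0 AW) hA).
  have : size inn <= size es by rewrite size_filter count_size.
  rewrite E; lia.
have [ds2 o2 h2] := IH _ _ _ _ _ hv2 m2.
have in2 : inside A ds2 by apply: (inside_orients o2); exact: filter_all.
have [ds3 o3 p3] := orients_perm pes (orients_cat o2 o).
exists ds3 => // v vW; rewrite -(net_perm _ p3) net_cat.
case vA: (v \in A); first by rewrite h2 // /b2 subrK.
by rewrite (net_out in2) ?vA // add0r hds // inE vA vW.
Qed.
End PartialOrientation.

(** * Deleting edges and arcs *)

(* The context is cleared: the relevant facts must be in the goal. *)
Ltac abslia :=
  repeat match goal with
  | |- context [deg ?e ?p ?q ?A] => move: (deg e p q A) => ?
  | |- context [cut ?e ?A] => move: (cut e A) => ?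
  | |- context [@bigop ?R ?I ?i ?r ?F] => move: (@bigop R I i r F) => ?
  | |- context [?x \in ?A] => move: (x \in A) => ?
  end; clear; lia.

Section Reductions.
Variable V : finType.
Implicit Types (es ds : seq (V * V)) (A W : {set V}) (b : V -> 'Z_3).
Implicit Types (p q : V -> nat).

Definition no_tight W es b p q := forall A,
  A \proper W -> 1 < #|A| -> ok (deg es p q A - 2) (bnd b p q A).

Lemma ok2_ge6 n z : ok (n - 2) z -> 6 <= n.
Proof. rewrite /ok; z3 z; z3lia. Qed.
Lemma ok_ge6 n z : 6 <= n -> ok n z.
Proof. by rewrite /ok => ->. Qed.
Lemma ok_ge4 n z : ok n z -> 4 <= n.
Proof. rewrite /ok; z3 z; z3lia. Qed.
(** Losing one edge lets |t| grow by at most one, while n >= 6 + |t| leaves a surplus of two. *)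
Lemma ok2_give n z : ok (n - 2) z -> ok n.-1 (z - 1)%R.
Proof. rewrite /ok; z3 z; z3lia. Qed.
Lemma ok2_take n z : ok (n - 2) z -> ok n.-1 (z + 1)%R.
Proof. rewrite /ok; z3 z; z3lia. Qed.
(** At most five remain unless n = 7 and z = 0, and then six remain with nonzero residue. *)
Lemma up_pred n z : up n z -> up n.-1 (z - 1)%R.
Proof. rewrite /up; z3 z; z3lia. Qed.

Lemma sum_mem1Z A (x : V) :
  (\sum_(v in A) ((x == v)%:R : 'Z_3) = (x \in A)%:R)%R.
Proof. by rewrite -natr_sum sum_mem1. Qed.

Lemma small_set A (x : V) : x \in A -> ~~ (1 < #|A|) -> A = [set x].
Proof.
move=> xA; rewrite -leqNgt => h; apply/eqP; rewrite eq_sym eqEcard cards1 h andbT.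
by rewrite sub1set.
Qed.

(** The edge is oriented from [x] to [y] and removed; [i] arcs from z0 to [y] and [j] arcs from [y]
    to z0 are put in its place. By [no_tight] only z0 and the two singletons need hypotheses;
    [i + j < 8] keeps the measure decreasing. *)
Lemma edge_move W es es' b p q x y i j :
  solves V (meas W es p q) -> valid W es b p q -> no_tight W es b p q ->
  gperm es ((x, y) :: es') -> x != y -> i + j < 8 ->
  up (\sum_(v in W) (p v + q v) + i + j) (bnd b p q W - i%:R + j%:R)%R ->
  ok (deg es p q [set x]).-1 (bnd b p q [set x] - 1)%R ->
  ok ((deg es p q [set y]).-1 + i + j) (bnd b p q [set y] + 1 - i%:R + j%:R)%R ->
  solvable W es b.
Proof.
move=> IH [hin hsum hup hok] hnt gp xy ij hup' okx oky.
have /= /andP[/andP[xW yW] hin'] := gperm_inside gp hin.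
pose b' v := (b v - (x == v)%:R + (y == v)%:R)%R.
pose p' v := p v + i * (y == v).
pose q' v := q v + j * (y == v).
have sumE A : \sum_(v in A) (p' v + q' v) =
    \sum_(v in A) (p v + q v) + (i + j) * (y \in A).
  rewrite -sum_mem1 big_distrr -big_split /=; apply: eq_bigr => v _.
  by rewrite /p' /q'; move: (p v) (q v) (y == v); abslia.
have cutE A : cut es A = ((x \in A) (+) (y \in A)) + cut es' A.
  by rewrite -(gperm_cut A gp) cut_cons.
have degE A : deg es' p' q' A + ((x \in A) (+) (y \in A)) =
    deg es p q A + (i + j) * (y \in A).
  by rewrite /deg cutE sumE; abslia.
have bndE A : bnd b' p' q' A = (bnd b p q A - (x \in A)%:R
    + (y \in A)%:R * (1 - i%:R + j%:R))%R.
  rewrite -(sum_mem1Z A x) -(sum_mem1Z A y) /bnd mulr_suml -sumrB -big_split /=.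
  by apply: eq_bigr => v _; rewrite /b' /p' /q' !natrD !natrM; ring.
apply: (gperm_solvable gp).
have [||ds o h] := IH W es' b' p' q'.
- split=> //.
  + rewrite !big_split sumrN /= !sum_mem1Z hsum xW yW; ring.
  + rewrite sumE bndE xW yW muln1 addnA.
    have -> // : (bnd b p q W - true%:R + true%:R * (1 - i%:R + j%:R) =
                  bnd b p q W - i%:R + j%:R)%R by rewrite /=; ring.
  + move=> A A0 AW; have := degE A; have := bndE A.
    have h2 := hnt A AW.
    case xA: (x \in A); case yA: (y \in A) => /= ->.
    * move=> D; apply: ok_ge6; have A1 : 1 < #|A|.
        by apply: contraNT xy => /(small_set xA) E; rewrite E inE in yA; rewrite eq_sym.
      by move: D (ok2_ge6 (h2 A1)); abslia.
    * rewrite muln0 => D; have -> : deg es' p' q' A = (deg es p q A).-1 by move: D; abslia.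
      have -> : (bnd b p q A - 1 + 0 * (1 - i%:R + j%:R) = bnd b p q A - 1)%R by ring.
      case A1: (1 < #|A|); first exact: ok2_give (h2 A1).
      by rewrite (small_set xA) ?A1.
    * rewrite muln1 => D; have -> : deg es' p' q' A = (deg es p q A).-1 + i + j.
        by move: D (ok_ge4 (hok A A0 AW)); abslia.
      have -> : (bnd b p q A - 0 + 1 * (1 - i%:R + j%:R) =
                 bnd b p q A + 1 - i%:R + j%:R)%R by ring.
      case A1: (1 < #|A|); last by rewrite (small_set yA) ?A1.
      (* Without new arcs the loss of one edge is covered by the surplus; otherwise the new arcs
         bring the degree back to at least six. *)
      case: (posnP (i + j)) => [/eqP|ij0].
        rewrite addn_eq0 => /andP[/eqP -> /eqP ->]; rewrite !addn0 subr0 addr0.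
        exact: ok2_take (h2 A1).
      by apply: ok_ge6; move: ij0 (ok2_ge6 (h2 A1)); abslia.
    * rewrite muln0 => D; have -> : deg es' p' q' A = deg es p q A by move: D; abslia.
      have -> : (bnd b p q A - 0 + 0 * (1 - i%:R + j%:R) = bnd b p q A)%R by ring.
      exact: hok.
- by rewrite /meas sumE yW -(gperm_size gp) /=; move: ij (size es') #|W|; abslia.
exists ((x, y) :: ds); first by rewrite /= eqxx.
by move=> v vW; rewrite net_cons h // /b' /=; ring.
Qed.

(** Removing an arc from [x] to z0 leaves [b] as it is, because [b] concerns the undirected edges
    only; the orientation found serves unchanged. *)
Lemma stub_move W es b p q x :
  solves V (meas W es p q) -> valid W es b p q -> no_tight W es b p q ->
  x \in W -> 0 < q x ->
  ok (deg es p q [set x]).-1 (bnd b p q [set x] - 1)%R ->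
  solvable W es b.
Proof.
move=> IH [hin hsum hup hok] hnt xW qx okx.
pose q' v := q v - (x == v).
have sumE A : \sum_(v in A) (p v + q' v) + (x \in A) = \sum_(v in A) (p v + q v).
  rewrite -sum_mem1 -big_split /=; apply: eq_bigr => v _.
  by rewrite /q'; case: eqP => [<-|_] /=; move: qx; move: (p _) (q _); abslia.
have bndE A : bnd b p q' A = (bnd b p q A - (x \in A)%:R)%R.
  rewrite -(sum_mem1Z A x) /bnd -sumrB.
  apply: eq_bigr => v _; rewrite /q' natrB; first by ring.
  by case: eqP => // <-.
have degE A : deg es p q' A + (x \in A) = deg es p q A.
  by rewrite /deg -sumE addnA.
apply: (IH W es b p q'); last first.
  by rewrite /meas; have := sumE W; rewrite xW; abslia.
split=> //.
  have := sumE W; rewrite bndE xW.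
  have -> : \sum_(v in W) (p v + q' v) = (\sum_(v in W) (p v + q v)).-1.
    by have := sumE W; rewrite xW; abslia.
  by move=> _; apply: up_pred.
move=> A A0 AW; have := degE A; rewrite bndE.
case xA: (x \in A) => D; last first.
  rewrite subr0; have -> : deg es p q' A = deg es p q A by move: D; abslia.
  exact: hok.
have -> : deg es p q' A = (deg es p q A).-1 by move: D; abslia.
case A1: (1 < #|A|); first exact: ok2_give (hnt _ AW A1).
by rewrite (small_set xA) ?A1.
Qed.

Lemma loop_move W es b p q x :
  solves V (meas W es p q) -> valid W es b p q -> (x, x) \in es -> solvable W es b.
Proof.
move=> IH [hin hsum hup hok] xes; have gp := gperm_edge xes.
apply: (gperm_solvable gp).
have /= /andP[_ hin'] := gperm_inside gp hin.
have cutE A : cut (rem (x, x) es) A = cut es A.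
  by rewrite -(gperm_cut A gp) cut_cons addbb.
have [||ds o h] := IH W (rem (x, x) es) b p q.
- by split=> // A A0 AW; rewrite /deg cutE; exact: hok.
- by rewrite /meas -(gperm_size gp) /=; move: (size _) #|W|; abslia.
exists ((x, x) :: ds); first by rewrite /= eqxx.
by move=> v vW; rewrite net_cons h // subrr add0r.
Qed.

Lemma valid_opp W es b p q :
  valid W es b p q -> valid W es (fun v => - b v)%R q p.
Proof.
have bE A : bnd (fun v => - b v)%R q p A = (- bnd b p q A)%R.
  by rewrite /bnd -sumrN; apply: eq_bigr => v _; ring.
have sE A : \sum_(v in A) (q v + p v) = \sum_(v in A) (p v + q v).
  by apply: eq_bigr => v _; rewrite addnC.
case=> hin hsum hup hok; split=> //.
- by rewrite sumrN hsum oppr0.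
- by rewrite bE upN sE.
- by move=> A A0 AW; rewrite /deg bE okN sE; exact: hok.
Qed.
End Reductions.

(** * Splitting off vertices *)

Section Splitting.
Variable V : finType.
Implicit Types (es ds : seq (V * V)) (A W : {set V}) (b : V -> 'Z_3).
Implicit Types (p q : V -> nat).

Lemma bnd_opp b p q A : bnd (fun v => - b v)%R q p A = (- bnd b p q A)%R.
Proof. by rewrite /bnd -sumrN; apply: eq_bigr => v _; ring. Qed.

Lemma deg_opp es p q A : deg es q p A = deg es p q A.
Proof. by rewrite /deg; congr (_ + _); apply: eq_bigr => v _; rewrite addnC. Qed.

Lemma meas_opp W es p q : meas W es q p = meas W es p q.
Proof. by rewrite /meas; congr (_ + _); apply: eq_bigr => v _; rewrite addnC. Qed.

Lemma no_tight_opp W es b p q :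
  no_tight W es b p q -> no_tight W es (fun v => - b v)%R q p.
Proof. by move=> h A AW A1; rewrite deg_opp bnd_opp okN; exact: h. Qed.

Lemma cutD W es A : inside W es -> A \subset W -> cut es (W :\: A) = cut es A.
Proof.
move=> hin AW; rewrite /cut !big_seq; apply: eq_bigr => e /(allP hin) /andP[e1 e2].
by rewrite !inE e1 e2 !andbT; case: (_ \in A); case: (_ \in A).
Qed.

Lemma bndD W b p q A : A \subset W ->
  (bnd b p q (W :\: A) = bnd b p q W - bnd b p q A)%R.
Proof.
by move=> AW; rewrite /bnd [in RHS](big_setID A) /= (setIidPr AW) addrAC subrr add0r.
Qed.

Lemma stubsD W p q A : A \subset W ->
  \sum_(v in W :\: A) (p v + q v) + \sum_(v in A) (p v + q v) =
  \sum_(v in W) (p v + q v).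
Proof. by move=> AW; rewrite [RHS](big_setID A) /= (setIidPr AW) addnC. Qed.

(** With t1 and t2 the representatives at the two vertices, that of the total is at most |t1| + |t2|
    in absolute value. Adding the two lower bounds gives 2m + c1 + c2 >= 8 + |t1| + |t2| >= 4 + c1 +
    c2. *)
Lemma two_vertices_num m c1 c2 z1 z2 :
  ok (m + c1) z1 -> ok (m + c2) z2 -> up (c1 + c2) (z1 + z2)%R -> 2 <= m.
Proof. rewrite /ok /up; z3 z1; z3 z2; z3lia. Qed.

Lemma two_vertices_solvable W es b p q :
  valid W es b p q -> (forall x, (x, x) \notin es) -> #|W| = 2 -> solvable W es b.
Proof.
move=> [hin hsum hup hok] hl /eqP /cards2P[x [y [xy WE]]].
have xW : [set x] \subset W by rewrite sub1set WE !inE eqxx.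
have yE : [set y] = W :\: [set x].
  apply/setP => v; rewrite WE !inE; case: (v =P x) => [->|] //=.
  by rewrite (negbTE xy).
have pr v w : v != w -> W = [set v; w] -> [set v] \proper W.
  move=> vw ->; rewrite properE subsetUl; apply/subsetPn; exists w; rewrite ?inE ?eqxx ?orbT //.
  by rewrite eq_sym.
have okx : ok (deg es p q [set x]) (bnd b p q [set x]).
  by apply: hok; [apply/set0Pn; exists x; rewrite inE | apply: pr xy WE].
have oky : ok (deg es p q [set y]) (bnd b p q [set y]).
  apply: hok; first by apply/set0Pn; exists y; rewrite inE.
  by apply: (pr y x); rewrite 1?eq_sym // setUC.
have mu : 2 <= cut es [set x].
  move: okx oky; rewrite /deg yE cutD // => okx oky.
  apply: (two_vertices_num okx oky).
  by rewrite addnC stubsD // bndD // addrC subrK.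
have [ys [rest [gp sz ysx _]]] := gperm_star (hl x).
have hin' := gperm_inside gp hin.
case: ys gp sz ysx hin' => [|y1 [|y2 ys]] gp sz; rewrite ?sz -?sz // in mu *.
move=> /= /and3P[y1x y2x _] /and3P[/andP[_ y1W] /andP[_ y2W] hin'].
have toy v : v \in W -> v != x -> v = y by rewrite WE !inE => /orP[/eqP ->|/eqP //]; rewrite eqxx.
rewrite (toy _ y1W y1x) (toy _ y2W y2x) /= in gp.
apply: (gperm_solvable gp); set s := map _ ys ++ rest in gp hin' *.
(* Two parallel edges contribute -2, 0 or 2 at [x], hence every residue modulo 3. The boundary at
   [y] then follows from the zero sums. *)
suff [d1 [d2 [o1 o2 E]]] : exists d1 d2,
    [/\ (d1 == (x, y)) || (d1 == flip (x, y)), (d2 == (x, y)) || (d2 == flip (x, y)) &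
        net (d1 :: d2 :: s) x = b x].
  have o : orients ((x, y) :: (x, y) :: s) [:: d1, d2 & s] by rewrite /= o1 o2 orients_refl.
  exists (d1 :: d2 :: s) => // v; rewrite WE !inE.
  have hi : inside W [:: d1, d2 & s].
    by apply: (inside_orients o); rewrite /= hin' WE !inE !eqxx !orbT.
  move: (sum_net_inside hi) hsum; rewrite WE !big_setU1 ?inE ?(negbTE xy) //= !big_set1 E.
  move=> e1 e2 /orP[/eqP -> //|/eqP ->].
  by apply: (addrI (b x)); rewrite e1 e2.
have yx : (y == x) = false by rewrite eq_sym; exact: negbTE.
case: (Z3_cases (b x - net s x)%R) => E.
- exists (x, y), (y, x); rewrite !eqxx orbT; split=> //.
  by rewrite !net_cons /= eqxx yx; rewrite -[b x](subrK (net s x)) E; ring.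
- exists (y, x), (y, x); rewrite !eqxx orbT; split=> //.
  rewrite !net_cons /= eqxx yx; rewrite -[b x](subrK (net s x)) E /= addrA.
  by congr (_ + _)%R; exact/val_inj.
- exists (x, y), (x, y); rewrite !eqxx; split=> //.
  rewrite !net_cons /= eqxx yx; rewrite -[b x](subrK (net s x)) E /= addrA.
  by congr (_ + _)%R; exact/val_inj.
Qed.

(* A pair of equal neighbours would cost a singleton two edges, unless that
   vertex occurs in the other pair as well. *)
Lemma pairing4 (ys : seq V) : size ys = 4 -> exists y1 y2 y3 y4,
  [/\ perm_eq ys [:: y1; y2; y3; y4], y1 = y2 -> y1 \in [:: y3; y4] &
      y3 = y4 -> y3 \in [:: y1; y2]].
Proof.
case: ys => [|a [|c [|d [|e [|]]]]] // _.
have pe : perm_eq [:: a; c; d; e] [:: a; d; c; e].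
  by rewrite perm_cons; apply/permP => f /=; lia.
case: (a =P c) => [<-|ac].
  case E: (a \in [:: d; e]).
    exists a, a, d, e; split=> // de; move: E; rewrite -de !inE orbb => /eqP ->.
    by rewrite eqxx.
  move/negbT: E; rewrite !inE negb_or => /andP[/eqP ad /eqP ae].
  by exists a, d, a, e; split=> //; rewrite perm_cons; apply/permP => f /=; lia.
case: (d =P e) => [<-|de]; last by exists a, c, d, e; split.
case E: (d \in [:: a; c]); first by exists a, c, d, d; split.
move/negbT: E; rewrite !inE negb_or => /andP[/eqP da /eqP dc].
exists a, d, c, d; split=> //; first by rewrite perm_cons; apply/permP => f /=; lia.
- by move/esym.
- by move/esym.
Qed.

(** The first neighbour will inherit the arc of z0, the other two will be joined. Joining equal
    neighbours costs a singleton two edges; if all three coincide, the surplus of that singleton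
    enlarged by the split vertex covers this. *)
Lemma pairing3 (ys : seq V) : size ys = 3 -> exists y1 y2 y3,
  perm_eq ys [:: y1; y2; y3] /\ (y2 = y3 -> y2 = y1).
Proof.
case: ys => [|a [|c [|d [|]]]] // _.
case: (c =P d) => [<-|cd]; last by exists a, c, d.
case: (c =P a) => [->|ca]; first by exists a, a, a.
exists c, a, c; split=> [|/esym //]; by apply/permP => f /=; lia.
Qed.

Lemma gperm_perm es es' es'' : gperm es es' -> perm_eq es' es'' -> gperm es es''.
Proof. by case=> m o pm pe; exists m => //; exact: perm_trans pm pe. Qed.

Lemma card_gt1 A (x y : V) : x \in A -> y \in A -> x != y -> 1 < #|A|.
Proof.
move=> xA yA; apply: contraNT => /(small_set xA) E.
by move: yA; rewrite E inE eq_sym.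
Qed.

Lemma cut_star A (x : V) (ys : seq V) :
  cut (map (pair x) ys) A = \sum_(y <- ys) ((x \in A) (+) (y \in A)).
Proof. by rewrite /cut big_map. Qed.

Lemma cut_setU1 es A x : all (fun e => (e.1 != x) && (e.2 != x)) es ->
  cut es (x |: A) = cut es A.
Proof.
move=> h; rewrite /cut !big_seq; apply: eq_bigr => e /(allP h) /andP[e1 e2].
by rewrite !inE (negbTE e1) (negbTE e2).
Qed.

Lemma inside_setD1 W es x : inside W es ->
  all (fun e => (e.1 != x) && (e.2 != x)) es -> inside (W :\ x) es.
Proof.
move=> hin h; apply/allP => e ei; have /andP[e1 e2] := allP hin e ei.
by have /andP[f1 f2] := allP h e ei; rewrite !inE e1 e2 f1 f2.
Qed.

Lemma setU1_proper W A x : x \in W -> A \proper W :\ x -> x |: A \proper W.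
Proof.
move=> xW /properP[sA [v]]; rewrite !inE => /andP[vx vW] vA.
rewrite properE subUset sub1set xW (subset_trans sA (subsetDl _ _)) /=.
by apply/subsetPn; exists v; rewrite // !inE negb_or vx.
Qed.
End Splitting.

Section Main.
Variable V : finType.
Implicit Types (es ds : seq (V * V)) (A W : {set V}) (b : V -> 'Z_3).
Implicit Types (p q : V -> nat).

Lemma bnd1 b p q (x : V) : bnd b p q [set x] = (b x - (p x)%:R + (q x)%:R)%R.
Proof. by rewrite /bnd big_set1. Qed.

Lemma deg1 es p q (x : V) : deg es p q [set x] = cut es [set x] + (p x + q x).
Proof. by rewrite /deg big_set1. Qed.

(** The degree of a set drops only if it contains a whole pair. With three or four neighbours
    inside, the surplus of the set enlarged by the split vertex suffices; with exactly one pair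
    inside, the surplus of the set itself does. *)
Lemma ok_mix (a1 a2 a3 a4 : bool) (r s : nat) z :
  ok (r + (a1 + a2 + a3 + a4) + s) z ->
  ((a1 && a2 && ~~ a3 && ~~ a4) || (~~ a1 && ~~ a2 && a3 && a4) ->
     ok (r + (a1 + a2 + a3 + a4) + s - 2) z) ->
  ok (r + (~~ a1 + ~~ a2 + ~~ a3 + ~~ a4) + s - 2) z ->
  ok ((a1 (+) a2) + ((a3 (+) a4) + r) + s) z.
Proof.
rewrite /ok; case: a1; case: a2; case: a3; case: a4; move: (z == 0%R) => /= t h1 h2 h3;
  try have {}h2 := h2 isT; move: h1 h2 h3; case: t => /=; lia.
Qed.

(** Only [a2 && a3] lowers the degree. The surplus of the enlarged set covers this when [a1] holds,
    and the second hypothesis when it does not. *)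
Lemma ok_mix3 (a1 a2 a3 : bool) (r s : nat) z :
  ok (r + (a1 + a2 + a3) + s) z ->
  (~~ a1 && a2 && a3 -> ok (r + (a1 + a2 + a3) + s - 2) z) ->
  ok (r + (~~ a1 + ~~ a2 + ~~ a3) + s.+1 - 2) z ->
  ok ((a2 (+) a3) + r + (s + a1)) z.
Proof.
rewrite /ok; case: a1; case: a2; case: a3; move: (z == 0%R) => /= t h1 h2 h3;
  try have {}h2 := h2 isT; move: h1 h2 h3; case: t => /=; lia.
Qed.

Lemma split4 W es b p q x :
  solves V (meas W es p q) -> valid W es b p q -> no_tight W es b p q ->
  (x, x) \notin es -> x \in W -> cut es [set x] = 4 ->
  p x = 0 -> q x = 0 -> b x = 0%R -> solvable W es b.
Proof.
move=> IH [hin hsum hup hok] hnt hl xW cx px qx bx.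
have [ys [rest [gp sz ysx restx]]] := gperm_star hl.
rewrite cx in sz; have [y1 [y2 [y3 [y4 [pe h12 h34]]]]] := pairing4 sz.
have {}gp := gperm_perm gp (perm_cat (perm_map (pair x) pe) (perm_refl rest)).
rewrite (perm_all _ pe) /= andbT in ysx.
have /= /and5P[/andP[_ w1] /andP[_ w2] /andP[_ w3] /andP[_ w4] hr] := gperm_inside gp hin.
case/and4P: ysx => n1 n2 n3 n4.
pose es' := (y1, y2) :: (y3, y4) :: rest.
have sumE (f : V -> nat) : f x = 0 -> \sum_(v in W) f v = \sum_(v in W :\ x) f v.
  by move=> fx; rewrite (big_setD1 x) //= fx.
have hv : valid (W :\ x) es' b p q.
  split.
  - by rewrite /= !inE w1 w2 w3 w4 n1 n2 n3 n4 /=; exact: inside_setD1.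
  - by move: hsum; rewrite (big_setD1 x) //= bx add0r.
  - have <- : bnd b p q W = bnd b p q (W :\ x).
      by rewrite /bnd [LHS](big_setD1 x) //= bx px qx subrr !add0r.
    by rewrite -(sumE (fun v => p v + q v)) ?px ?qx.
  - move=> A A0 AW; have AsW := proper_sub AW.
    have xA : x \notin A.
      by apply/negP => /(subsetP AsW); rewrite !inE eqxx.
    have AW' : A \proper W by apply: proper_sub_trans AW (subsetDl _ _).
    have UW := setU1_proper xW AW.
    have bU : bnd b p q (x |: A) = bnd b p q A.
      by rewrite /bnd big_setU1 //= bx px qx subrr !add0r.
    have cE B : cut es B = cut rest B + (((x \in B) (+) (y1 \in B)) +
        ((x \in B) (+) (y2 \in B)) + ((x \in B) (+) (y3 \in B)) + ((x \in B) (+) (y4 \in B))).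
      by rewrite -(gperm_cut B gp) cut_cat cut_star !big_cons big_nil; abslia.
    have sU : \sum_(v in x |: A) (p v + q v) = \sum_(v in A) (p v + q v).
      by rewrite big_setU1 //= px qx.
    rewrite /deg /es' !cut_cons /=; apply: ok_mix => //.
    + by have := hok A A0 AW'; rewrite /deg cE (negbTE xA) /=.
    + move=> h; have := hnt A AW'; rewrite /deg cE (negbTE xA) /=; apply.
      case/orP: h => /andP[/andP[/andP[]]].
        move=> a1 a2 a3 a4; apply: (card_gt1 a1 a2); apply/eqP => /h12; rewrite !inE.
        by case/orP => /eqP E; rewrite -E a1 in a3 a4.
      move=> a1 a2 a3 a4; apply: (card_gt1 a3 a4); apply/eqP => /h34; rewrite !inE.
      by case/orP => /eqP E; rewrite -E a3 in a1 a2.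
    + have := hnt _ UW; rewrite bU /deg cE sU cut_setU1 // !inE eqxx /=.
      rewrite (negbTE n1) (negbTE n2) (negbTE n3) (negbTE n4) /=; apply.
      by case/set0Pn: A0 => v vA; rewrite cardsU1 xA ltnS card_gt0; apply/set0Pn; exists v.
have hm : meas (W :\ x) es' p q < meas W es p q.
  rewrite /meas -(gperm_size gp) sumE ?px ?qx // (cardsD1 x W) xW /=.
  by move: (size rest) #|_|; abslia.
have [ds o h] := IH _ _ _ _ _ hv hm.
apply: (gperm_solvable gp).
case: ds o h => [|d1 [|d2 ds]] //=; first by rewrite andbF.
case/and3P=> o1 o2 o3 h.
have dsin : inside (W :\ x) ds.
  by apply: (inside_orients o3); exact: inside_setD1.
(* Each new edge is subdivided by [x] in its own direction, which adds nothing at [x] and keeps its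
   contribution elsewhere. *)
have lift d u w : (d == (u, w)) || (d == flip (u, w)) ->
    exists e1 e2, [/\ (e1 == (x, u)) || (e1 == flip (x, u)),
      (e2 == (x, w)) || (e2 == flip (x, w)) & forall v,
      ((e1.1 == v)%:R - (e1.2 == v)%:R + ((e2.1 == v)%:R - (e2.2 == v)%:R) =
       (d.1 == v)%:R - (d.2 == v)%:R :> 'Z_3)%R].
  case/orP=> /eqP ->.
    exists (u, x), (x, w); rewrite !eqxx ?orbT; split=> // v /=; ring.
  exists (x, u), (w, x); rewrite !eqxx ?orbT; split=> // v /=; ring.
have [e1 [e2 [f1 f2 E1]]] := lift _ _ _ o1.
have [e3 [e4 [f3 f4 E2]]] := lift _ _ _ o2.
exists [:: e1, e2, e3, e4 & ds]; first by rewrite /= f1 f2 f3 f4.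
move=> v vW; rewrite !net_cons.
have -> : (forall a1 a2 a3 a4 c : 'Z_3, a1 + (a2 + (a3 + (a4 + c))) =
   (a1 + a2) + ((a3 + a4) + c))%R by move=> *; ring.
rewrite E1 E2 -!net_cons; case: (v =P x) => [->|/eqP vx]; last first.
  by apply: h; rewrite !inE vx.
rewrite bx; apply: (@net_out _ (W :\ x)); last by rewrite !inE eqxx.
by apply: (@inside_orients _ _ es' [:: d1, d2 & ds]);
   [rewrite /= o1 o2 | case: hv].
Qed.

Lemma split3 W es b p q x :
  solves V (meas W es p q) -> valid W es b p q -> no_tight W es b p q ->
  (x, x) \notin es -> x \in W -> cut es [set x] = 3 ->
  p x = 1 -> q x = 0 -> b x = 1%R -> solvable W es b.
Proof.
move=> IH [hin hsum hup hok] hnt hl xW cx px qx bx.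
have [ys [rest [gp sz ysx restx]]] := gperm_star hl.
rewrite cx in sz; have [y1 [y2 [y3 [pe h23]]]] := pairing3 sz.
have {}gp := gperm_perm gp (perm_cat (perm_map (pair x) pe) (perm_refl rest)).
rewrite (perm_all _ pe) /= andbT in ysx.
have /= /and4P[/andP[_ w1] /andP[_ w2] /andP[_ w3] hr] := gperm_inside gp hin.
case/and3P: ysx => n1 n2 n3.
pose es' := (y2, y3) :: rest.
(* The path z0 -> [x] -> [y1] becomes an arc from z0 to [y1]. As [b] ignores arcs, the loss of the
   edge entering [y1] raises [b y1] by 1. *)
pose b' v := (b v + (y1 == v)%:R)%R.
pose p' v := p v + (y1 == v).
have y1W : y1 \in W :\ x by rewrite !inE n1 w1.
have sE A : \sum_(v in A) (p' v + q v) = \sum_(v in A) (p v + q v) + (y1 \in A).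
  rewrite -sum_mem1 -big_split; apply: eq_bigr => v _; rewrite /p' /=.
  by move: (p v) (q v) (y1 == v); abslia.
have bE A : bnd b' p' q A = bnd b p q A.
  by apply: eq_bigr => v _; rewrite /b' /p' natrD; ring.
have sW : \sum_(v in W) (p v + q v) = \sum_(v in W :\ x) (p' v + q v).
  by rewrite sE y1W (big_setD1 x) //= px qx addnC.
have bx0 : (b x - (p x)%:R + (q x)%:R = 0)%R by rewrite bx px qx; exact/val_inj.
have hv : valid (W :\ x) es' b' p' q.
  split.
  - by rewrite /= !inE w2 w3 n2 n3 /=; exact: inside_setD1.
  - rewrite big_split sum_mem1Z y1W -[RHS]hsum [RHS](big_setD1 x) //= bx.
    by rewrite addrC.
  - rewrite bE -sW; have <- // : bnd b p q W = bnd b p q (W :\ x).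
    by rewrite /bnd [LHS](big_setD1 x) //= bx0 add0r.
  - move=> A A0 AW; have AsW := proper_sub AW.
    have xA : x \notin A.
      by apply/negP => /(subsetP AsW); rewrite !inE eqxx.
    have AW' : A \proper W by apply: proper_sub_trans AW (subsetDl _ _).
    have UW := setU1_proper xW AW.
    have bU : bnd b p q (x |: A) = bnd b p q A.
      by rewrite /bnd big_setU1 //= bx0 add0r.
    have cE B : cut es B = cut rest B + (((x \in B) (+) (y1 \in B)) +
        ((x \in B) (+) (y2 \in B)) + ((x \in B) (+) (y3 \in B))).
      by rewrite -(gperm_cut B gp) cut_cat cut_star !big_cons big_nil; abslia.
    have sU : \sum_(v in x |: A) (p v + q v) = (\sum_(v in A) (p v + q v)).+1.
      by rewrite big_setU1 //= px qx.
    rewrite bE /deg /es' !cut_cons sE /=; apply: ok_mix3 => //.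
    + by have := hok A A0 AW'; rewrite /deg cE (negbTE xA) /=.
    + move=> /andP[/andP[a1 a2] a3]; have := hnt A AW'.
      rewrite /deg cE (negbTE xA) /=; apply.
      by apply: (card_gt1 a2 a3); apply/eqP => /h23 E; rewrite E (negbTE a1) in a2.
    + have := hnt _ UW; rewrite bU /deg cE sU cut_setU1 // !inE eqxx /=.
      rewrite (negbTE n1) (negbTE n2) (negbTE n3) /=; apply.
      by case/set0Pn: A0 => v vA; rewrite cardsU1 xA ltnS card_gt0; apply/set0Pn; exists v.
have hm : meas (W :\ x) es' p' q < meas W es p q.
  rewrite /meas -(gperm_size gp) sW (cardsD1 x W) xW /=.
  by move: (size rest) #|_|; abslia.
have [ds o h] := IH _ _ _ _ _ hv hm.
apply: (gperm_solvable gp).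
case: ds o h => [|d1 ds] //= /andP[o1 o3] h.
have [e2 [e3 [f2 f3 E1]]] :
    exists e1 e2, [/\ (e1 == (x, y2)) || (e1 == flip (x, y2)),
      (e2 == (x, y3)) || (e2 == flip (x, y3)) & forall v,
      ((e1.1 == v)%:R - (e1.2 == v)%:R + ((e2.1 == v)%:R - (e2.2 == v)%:R) =
       (d1.1 == v)%:R - (d1.2 == v)%:R :> 'Z_3)%R].
  case/orP: o1 => /eqP ->.
    exists (y2, x), (x, y3); rewrite !eqxx ?orbT; split=> // v /=; ring.
  exists (x, y2), (y3, x); rewrite !eqxx ?orbT; split=> // v /=; ring.
exists [:: (x, y1), e2, e3 & ds]; first by rewrite /= f2 f3 eqxx.
move=> v vW; rewrite !net_cons.
have -> : (forall a1 a2 a3 c : 'Z_3, a1 + (a2 + (a3 + c)) = a1 + ((a2 + a3) + c))%R.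
  by move=> *; ring.
rewrite E1 -(net_cons d1); case: (v =P x) => [->|/eqP vx]; last first.
  by rewrite h ?inE ?vx // /b' /= [x == v]eq_sym (negbTE vx) /=; ring.
rewrite bx /= eqxx (negbTE n1) (@net_out _ (W :\ x)) ?inE ?eqxx //.
  exact/val_inj.
by apply: (@inside_orients _ _ es' (d1 :: ds)); [rewrite /= o1 | case: hv].
Qed.

(** Of the [k] arcs at z0, [e] are at the vertex of degree 4. The remaining vertices have degree (4
    - e) + (k - e) and must keep 4 + |t| after losing two, whereas k <= 4 + |t|. *)
Lemma split_num k e z : up k z -> e <= k -> e <= 4 -> ok ((4 - e) + (k - e) - 2) z -> e <= 1.
Proof. rewrite /ok /up; z3 z; z3lia. Qed.

(** At most one arc is at [x], leaving four edges, or three edges and an arc; an arc towards z0 is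
    treated by reversal. *)
Lemma split_solvable W es b p q x :
  solves V (meas W es p q) -> valid W es b p q -> no_tight W es b p q ->
  (x, x) \notin es -> x \in W -> 2 < #|W| ->
  deg es p q [set x] = 4 -> bnd b p q [set x] = 0%R -> solvable W es b.
Proof.
move=> IH hv hnt hl xW W3 dx bx.
have sxW : [set x] \subset W by rewrite sub1set.
have cW : #|W :\ x| = #|W|.-1 by rewrite (cardsD1 x W) xW.
have e1 : p x + q x <= 1.
  have pW : W :\ x \proper W by rewrite properD1.
  have W1 : 1 < #|W :\ x| by rewrite cW; move: W3; move: #|W|; clear; lia.
  have := hnt _ pW W1.
  case: hv => hin _ hup _; rewrite /deg cutD // bndD // bx subr0.
  have := stubsD p q sxW; rewrite big_set1 /=.
  move: dx; rewrite deg1 => dx sE.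
  have -> : cut es [set x] = 4 - (p x + q x) by move: dx; move: (p x + q x); abslia.
  have -> : \sum_(v in W :\ x) (p v + q v) = \sum_(v in W) (p v + q v) - (p x + q x).
    by rewrite -sE addnK.
  apply: split_num hup _ _; first by rewrite -sE leq_addl.
  by rewrite -dx leq_addl.
move: dx bx; rewrite deg1 bnd1 => dx bx.
have {e1} : [\/ p x = 0 /\ q x = 0, p x = 1 /\ q x = 0 | p x = 0 /\ q x = 1].
  case: (p x) (q x) e1 => [|[|a]] [|[|c]] // _.
  - by constructor 1.
  - by constructor 3.
  - by constructor 2.
case=> -[px qx]; rewrite px qx in dx bx.
- apply: (split4 IH hv hnt hl xW) => //; first by rewrite !addn0 in dx.
  by move: bx; rewrite subr0 addr0.
- apply: (split3 IH hv hnt hl xW) => //; first by rewrite addn0 addn1 in dx; case: dx.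
  by move/eqP: bx; rewrite addr0 subr_eq0 => /eqP.
- apply: solvable_opp; rewrite -meas_opp in IH.
  apply: (split3 IH (valid_opp hv) (no_tight_opp hnt) hl xW) => //.
    by rewrite add0n addn1 in dx; case: dx.
  by move/eqP: bx; rewrite subr0 addr_eq0 => /eqP ->; rewrite opprK.
Qed.

(** * The main induction *)

(** Otherwise [A] and its complement would each need at least four arcs of z0, which has at most
    seven. *)
Lemma cut_gt0 W es b p q A :
  valid W es b p q -> A != set0 -> A \proper W -> 0 < cut es A.
Proof.
case=> hin hsum hup hok A0 AW; rewrite lt0n; apply/eqP => c0.
have AsW := proper_sub AW.
have D0 : W :\: A != set0 by rewrite setD_eq0; move: AW; rewrite properE => /andP[].
have DW : W :\: A \proper W.
  rewrite properE subsetDl; case/set0Pn: A0 => v vA.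
  by apply/subsetPn; exists v; rewrite ?(subsetP AsW) // inE vA.
move: (ok_ge4 (hok _ A0 AW)) (ok_ge4 (hok _ D0 DW)) (stubsD p q AsW) (up_le7 hup).
rewrite /deg cutD // c0; abslia.
Qed.

(** With all arcs leaving z0 the boundary is minus their number: six give 0 and seven give -1, both
    violating the upper bound. *)
Lemma up_all_out k : up k (- k%:R)%R -> k <= 5.
Proof. by rewrite /up; case: k => [|[|[|[|[|[|[|[|k]]]]]]]]. Qed.

Lemma setD1_edge W es b p q y : valid W es b p q -> 1 < #|W| -> y \in W ->
  exists2 x, x \in W & x != y /\ exists es', gperm es ((x, y) :: es').
Proof.
move=> hv W1 yW.
have D0 : W :\ y != set0 by rewrite -card_gt0; move: W1; rewrite (cardsD1 y W) yW.
have DW : W :\ y \proper W by rewrite properD1.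
have [x [y' [es' [gp]]]] := cut_edge (cut_gt0 hv D0 DW).
rewrite !inE => /andP[xy xW]; have /= /andP[/andP[_ y'W] _] := gperm_inside gp (valid_in hv).
rewrite y'W andbT negbK => /eqP E; rewrite E in gp.
by exists x => //; split=> //; exists es'.
Qed.

Lemma all_give_solvable W es b p q :
  solves V (meas W es p q) -> valid W es b p q -> no_tight W es b p q -> 1 < #|W| ->
  (forall x, x \in W -> 5 <= deg es p q [set x]) ->
  (forall x, x \in W -> ok (deg es p q [set x]).-1 (bnd b p q [set x] - 1)%R) ->
  solvable W es b.
Proof.
move=> IH hv hnt W1 h5 hg.
have [/existsP[x /andP[xW qx]]|] := boolP [exists x, (x \in W) && (0 < q x)].
  exact: (stub_move IH hv hnt xW qx (hg x xW)).
rewrite negb_exists => /forallP q0.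
have {}q0 v : v \in W -> q v = 0 by move=> vW; have := q0 v; rewrite vW lt0n negbK => /eqP.
set k := \sum_(v in W) (p v + q v).
have bW : bnd b p q W = (- k%:R)%R.
  rewrite -(sub0r k%:R) -(valid_sum hv) /k natr_sum -sumrB.
  by apply: eq_bigr => v vW; rewrite (q0 v vW) addn0 addr0.
have k5 : k <= 5 by apply: up_all_out; rewrite -bW; exact: valid_up hv.
have [y yW] : exists y, y \in W by apply/set0Pn; rewrite -card_gt0 ltnW.
have [x xW [xy [es' gp]]] := setD1_edge hv W1 yW.
have y5 := h5 y yW.
(* The new arc from z0 to [y] restores degree and boundary at [y], and z0 then has at most five
   arcs, which is always allowed. *)
case k4: (k <= 4).
  apply: (@edge_move _ W es es' b p q x y 1 0 IH hv hnt gp xy) => //.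
  - by rewrite -/k /up; move: k4; clear; lia.
  - exact: hg.
  - rewrite addn0 addn1 prednK ?(ltn_trans _ y5) //.
    rewrite addr0 addrK; apply: (valid_ok hv); first by apply/set0Pn; exists y; rewrite inE.
    by rewrite properE sub1set yW; apply/subsetPn; exists x; rewrite ?inE.
(* Two arcs from [y] bring z0 to seven arcs with boundary -5 + 2 = 0 modulo 3, the extreme case of
   [up]; [y] gets degree at least 5 - 1 + 2. *)
have kE : k = 5 by move: k5 k4; clear; lia.
apply: (@edge_move _ W es es' b p q x y 0 2 IH hv hnt gp xy) => //.
- by rewrite -/k bW kE.
- exact: hg.
- by apply: ok_ge6; move: y5; abslia.
Qed.

(** Degree 5 with residue 1 or -1 drops to degree 4 with residue 0 in one of the two ways; degree 6
    drops to 5 with nonzero residue in at least one. *)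
Lemma give_or_take n z : ok n z -> ~~ ((n == 4) && (z == 0%R)) ->
  ok n.-1 (z - 1)%R || ok n.-1 (z + 1)%R.
Proof. rewrite /ok; z3 z; z3lia. Qed.

Lemma ok_neq4 n z : ok n z -> ~~ ((n == 4) && (z == 0%R)) -> 5 <= n.
Proof. rewrite /ok; z3 z; z3lia. Qed.

Theorem valid_solvable W es b p q : valid W es b p q -> solvable W es b.
Proof.
suff: forall m, solves V m by move=> h hv; exact: (h (meas W es p q).+1 _ _ _ _ _ hv (ltnSn _)).
elim=> [|m IHm] {}W {}es {}b {}p {}q hv //; rewrite ltnS => le_m.
have IH : solves V (meas W es p q).
  by move=> W' es' b' p' q' hv' lt; apply: IHm hv' _; exact: leq_trans lt le_m.
have [/hasP[[x y] xye /= /eqP E]|/hasPn hl] := boolP (has (fun e => e.1 == e.2) es).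
  by rewrite -E in xye; exact: loop_move IH hv xye.
have {}hl x : (x, x) \notin es by apply/negP => /hl /=; rewrite eqxx.
have hin := valid_in hv.
(* On at most one vertex every orientation has boundary zero, as does [b]. *)
case W1: (#|W| <= 1).
  exists es => [|v vW]; first exact: orients_refl.
  have E : W = [set v] by apply: small_set => //; rewrite -leqNgt.
  have := sum_net_inside hin; have := valid_sum hv.
  by rewrite E !big_set1 => -> ->.
case W2: (#|W| == 2); first exact: two_vertices_solvable hv hl (eqP W2).
have W3 : 2 < #|W| by move: W1 W2; move: #|W|; clear; lia.
have [/existsP[A /and3P[AW A1 tA]]|] := boolP [exists A : {set V},
    [&& A \proper W, 1 < #|A| & ~~ ok (deg es p q A - 2) (bnd b p q A)]].
  exact: tight_solvable IH hv AW A1 tA.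
rewrite negb_exists => /forallP hnt.
have {}hnt : no_tight W es b p q.
  by move=> A AW A1; have := hnt A; rewrite AW A1 negbK.
have [/existsP[x /and3P[xW /eqP dx /eqP bx]]|] := boolP [exists x,
    [&& x \in W, deg es p q [set x] == 4 & bnd b p q [set x] == 0%R]].
  exact: split_solvable IH hv hnt (hl x) xW W3 dx bx.
rewrite negb_exists => /forallP h4.
have {}h4 x : x \in W -> ~~ ((deg es p q [set x] == 4) && (bnd b p q [set x] == 0%R)).
  by move=> xW; have := h4 x; rewrite xW.
have hok x : x \in W -> ok (deg es p q [set x]) (bnd b p q [set x]).
  move=> xW; apply: (valid_ok hv); first by apply/set0Pn; exists x; rewrite inE.
  by rewrite properEcard sub1set xW cards1 ltnW.
have h5 x : x \in W -> 5 <= deg es p q [set x].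
  by move=> xW; exact: ok_neq4 (hok x xW) (h4 x xW).
pose give x := ok (deg es p q [set x]).-1 (bnd b p q [set x] - 1)%R.
pose S := [set x in W | give x].
have take x : x \in W -> x \notin S -> ok (deg es p q [set x]).-1 (bnd b p q [set x] + 1)%R.
  move=> xW; rewrite inE xW /= => xS.
  by have := give_or_take (hok x xW) (h4 x xW); rewrite -/(give x) (negbTE xS).
have SW : S \subset W by apply/subsetP => x; rewrite inE => /andP[].
case SE: (S == W).
  apply: all_give_solvable IH hv hnt (ltnW W3) h5 _ => x.
  by rewrite -(eqP SE) inE => /andP[].
case S0: (S == set0).
  apply: solvable_opp; rewrite -meas_opp in IH.
  apply: all_give_solvable IH (valid_opp hv) (no_tight_opp hnt) (ltnW W3) _ _ => x xW.
    by rewrite deg_opp h5.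
  by rewrite deg_opp bnd_opp -opprD okN take // (eqP S0) inE.
have SP : S \proper W by rewrite properEneq SE SW.
have [x [y [es' [gp xS yS]]]] := cut_edge (cut_gt0 hv (negbT S0) SP).
have /= /andP[/andP[xW yW] _] := gperm_inside gp hin.
apply: (@edge_move _ W es es' b p q x y 0 0 IH hv hnt gp) => //.
- by apply: contraNneq yS => <-.
- by rewrite !addn0 subr0 addr0; exact: valid_up hv.
- by move: xS; rewrite inE => /andP[].
- by rewrite !addn0 subr0 addr0; exact: take.
Qed.
End Main.

(** * Minimal sides of small cuts *)

Section Multigraph.
Variable G : mgraph.
Implicit Types (A B : {set vertex G}) (e : edge G) (p q : vertex G -> nat).

Lemma ends_pair e : exists d : vertex G * vertex G, ends e == [set d.1; d.2].
Proof.
have /eqP/cards2P[x [y [_ E]]] := card_ends e.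
by exists (x, y); rewrite E.
Qed.

Definition refdir e := xchoose (ends_pair e).

Lemma endsE e : ends e = [set (refdir e).1; (refdir e).2].
Proof. exact/eqP/(xchooseP (ends_pair e)). Qed.

Lemma in_boundary e A :
  (e \in boundary A) = ((refdir e).1 \in A) (+) ((refdir e).2 \in A).
Proof.
rewrite inE endsE; have := card_ends e; rewrite endsE cards2.
case: (refdir e) => x y /= /eqP; rewrite eqSS eqb1 => xy.
rewrite setIUl.
have h z : [set z] :&: A = if z \in A then [set z] else set0.
  by apply/setP => v; rewrite !inE; case: (v =P z) => [->|]; case: ifP; rewrite ?inE ?eqxx // => _;
     case: eqP.
rewrite !h; case: ifP => _; case: ifP => _ /=;
  by rewrite ?setU0 ?set0U ?cards2 ?cards1 ?cards0 ?xy.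
Qed.

Definition edge_list := [seq refdir e | e <- enum (edge G)].

Lemma cut_edge_list A : cut edge_list A = #|boundary A|.
Proof.
rewrite /cut big_map big_enum /= -sum1_card [RHS]big_mkcond /=.
by apply: eq_bigr => e _; rewrite in_boundary; case: (_ (+) _).
Qed.

(** Parallel edges may share a pair, so [ds] is read as a function of the edge, which needs [s] free
    of repetitions. *)
Lemma orients_edge_map (s : seq (edge G)) ds :
  orients [seq refdir e | e <- s] ds -> uniq s ->
  exists2 D, ds = map D s &
    forall e, e \in s -> (D e == refdir e) || (D e == flip (refdir e)).
Proof.
elim: s ds => [|e s IH] [|d ds] //=; first by exists refdir.
case/andP=> hd /IH{}IH /andP[es /IH[D -> hD]].
exists (fun f => if f == e then d else D f) => [|f].
  rewrite eqxx; congr (_ :: _); apply/eq_in_map => f fs.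
  by case: eqP => // E; rewrite -E fs in es.
by rewrite inE; case: eqP => [->|_ /= /hD].
Qed.

Lemma beta_orientation_of_stubs (beta : vertex G -> 'Z_3) p q :
  boundary_function beta ->
  up (\sum_v (p v + q v)) (\sum_v ((q v)%:R - (p v)%:R))%R ->
  (forall A, A != set0 -> A != setT ->
    ok (#|boundary A| + \sum_(v in A) (p v + q v))
       (\sum_(v in A) beta v + \sum_(v in A) ((q v)%:R - (p v)%:R))%R) ->
  exists D, beta_orientation beta D.
Proof.
move=> hb hup hok.
have bE A : bnd beta p q A =
    (\sum_(v in A) beta v + \sum_(v in A) ((q v)%:R - (p v)%:R))%R.
  by rewrite -big_split; apply: eq_bigr => v _ /=; ring.
have inT (R : Type) (idx : R) (op : Monoid.com_law idx) (f : vertex G -> R) :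
    \big[op/idx]_(v in setT) f v = \big[op/idx]_v f v.
  by apply: eq_bigl => v; rewrite inE.
have hv : valid setT edge_list beta p q.
  split.
  - by apply/allP => e _; rewrite !inE.
  - by rewrite inT.
  - by rewrite bE !inT (hb : (\sum_v beta v = 0)%R) add0r.
  - move=> A A0 AT; rewrite /deg cut_edge_list bE; apply: hok => //.
    by move: AT; rewrite properT.
have [ds o h] := valid_solvable hv.
have [D E hD] := orients_edge_map o (enum_uniq _).
exists D; split=> [e|v].
  rewrite endsE; have := hD e; rewrite mem_enum => /(_ isT) /orP[] /eqP -> //=.
  by rewrite setUC.
rewrite -(h v) ?inE // /net; congr (_%:R - _%:R)%R;
  rewrite E /outs /ins big_map big_enum /= /outdeg /indeg -sum1_card big_mkcond /=;
  by apply: eq_bigr => e _; rewrite inE; case: ifP.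
Qed.

Lemma boundaryC A : boundary (~: A) = boundary A.
Proof. by apply/setP => e; rewrite !in_boundary !inE addbN addNb negbK. Qed.

Lemma boundary_submod A B :
  #|boundary (A :&: B)| + #|boundary (A :|: B)| <= #|boundary A| + #|boundary B|.
Proof.
rewrite -!cut_edge_list /cut -!big_split /=; apply: leq_sum => e _; rewrite !inE.
by case: (_ \in A); case: (_ \in B); case: (_ \in A); case: (_ \in B).
Qed.

Lemma cut_in A : A != set0 -> A != setT -> boundary A \in cuts G.
Proof. by move=> A0 AT; apply/imsetP; exists A; rewrite // inE A0 AT. Qed.

Lemma setC_neq0 A : (~: A != set0) = (A != setT).
Proof. by rewrite -setCT (inj_eq (@setC_inj _)). Qed.

Lemma setC_neqT A : (~: A != setT) = (A != set0).
Proof. by rewrite -setC0 (inj_eq (@setC_inj _)). Qed.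

Variable k : nat.
Hypothesis k_gt0 : 0 < k.
Hypothesis conn : edge_connected G k.

Lemma boundary_ge A : A != set0 -> A != setT -> k <= #|boundary A|.
Proof. by move=> A0 AT; apply: conn; exact: cut_in. Qed.

(** The symmetric difference of [A] and [B] has empty boundary, so by connectivity it is empty or
    everything. *)
Lemma boundary_inj A B : boundary A = boundary B -> B = A \/ B = ~: A.
Proof.
move=> E; pose S := [set v | (v \in A) (+) (v \in B)].
have bS : boundary S = set0.
  apply/setP => e; have := in_boundary e A; rewrite E in_boundary !in_boundary !inE.
  by case: (_ \in A); case: (_ \in A); case: (_ \in B); case: (_ \in B).
have [S0|S0] := eqVneq S set0.
  left; apply/setP => v; have := in_set0 v; rewrite -S0 inE.
  by case: (v \in A); case: (v \in B).
have [ST|ST] := eqVneq S setT.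
  right; apply/setP => v; have := in_setT v; rewrite -ST !inE.
  by case: (v \in A); case: (v \in B).
by have := boundary_ge S0 ST; rewrite bS cards0 leqNgt k_gt0.
Qed.

Definition sides := [set A : {set vertex G} | [&& A != set0, A != setT & #|boundary A| == k]].
Definition minsides := [set A : {set vertex G} | minset (fun B => B \in sides) A].

Lemma sidesC A : A \in sides -> ~: A \in sides.
Proof. by rewrite !inE setC_neq0 setC_neqT boundaryC => /and3P[-> -> ->]. Qed.

Lemma sides_neq0 A : A \in sides -> A != set0.
Proof. by rewrite inE => /and3P[]. Qed.

Lemma boundary_gt A : A != set0 -> A != setT -> A \notin sides -> k < #|boundary A|.
Proof.
move=> A0 AT; rewrite inE A0 AT /= => h.
by rewrite ltn_neqAle eq_sym h boundary_ge.
Qed.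

Lemma minsideP A : A \in minsides -> A \in sides.
Proof. by rewrite inE => /minsetp. Qed.

Lemma minside_min A B : A \in minsides -> B \in sides -> B \subset A -> B = A.
Proof. by rewrite inE => /minsetP[_ h] /h. Qed.

Lemma minside_exists B : B \in sides -> exists2 A, A \in minsides & A \subset B.
Proof.
move=> hB; have [A mA AB] := @minset_exists _ (fun B => B \in sides) _ hB.
by exists A; rewrite ?inE.
Qed.

(** If [A] and [B] meet and do not cover all vertices, submodularity makes their intersection a
    side, equal to [A] by minimality. If they cover, the complement of [B] is a side inside [A],
    hence equal to [A]. *)
Lemma minside_cases A B :
  A \in minsides -> B \in sides -> A \subset B \/ A \subset ~: B.
Proof.
move=> mA sB; have sA := minsideP mA.
have [AB|AB] := eqVneq (A :&: B) set0; first by right; rewrite -disjoints_subset -setI_eq0 AB.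
have [U|U] := eqVneq (A :|: B) setT.
  right; rewrite (_ : ~: B = A) //; apply: minside_min => //; first exact: sidesC.
  apply/subsetP => v; have := in_setT v; rewrite -U !inE.
  by case: (v \in A); case: (v \in B).
left; have := boundary_submod A B.
have IT : A :&: B != setT.
  by apply: contraNneq U => E; rewrite -subTset -E; apply/subsetP => v; rewrite !inE => /andP[->].
have U0 : A :|: B != set0.
  by apply: contraNneq AB => E; rewrite -subset0 -E; apply/subsetP => v; rewrite !inE => /andP[->].
have := boundary_ge U0 U; have := boundary_ge AB IT.
move: (sA) sB; rewrite !inE => /and3P[_ _ /eqP ->] /and3P[_ _ /eqP ->] h1 h2 h3.
have sI : A :&: B \in sides by rewrite inE AB IT /= eqn_leq h1 andbT; move: h1 h2 h3; clear; lia.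
by apply/setIidPl/minside_min => //; exact: subsetIl.
Qed.

Lemma minside_disjoint A B :
  A \in minsides -> B \in minsides -> A != B -> A \subset ~: B.
Proof.
move=> mA mB AB; have [h|//] := minside_cases mA (minsideP mB).
by rewrite (minside_min mB (minsideP mA) h) eqxx in AB.
Qed.

(** Two distinct minimal sides with the same cut are complementary, so a third one, disjoint from
    both, would be empty. *)
Lemma boundary_minsides_inj : 2 < #|minsides| -> {in minsides &, injective (@boundary G)}.
Proof.
move=> M3 A B mA mB /boundary_inj[//|E].
have [D mD] : exists D, D \in minsides :\: [set A; B].
  apply/set0Pn; rewrite -card_gt0 cardsD subn_gt0; apply: leq_ltn_trans M3.
  apply: leq_trans (subset_leq_card (subsetIr _ _)) _.
  by rewrite cards2; case: (_ != _).
move: mD; rewrite !inE negb_or => /andP[/andP[DA DB]].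
rewrite -/minsides => mD; have {}mD : D \in minsides by rewrite inE.
have h1 := minside_disjoint mD mA DA; have h2 := minside_disjoint mD mB DB.
have /set0Pn[v vD] := sides_neq0 (minsideP mD).
have := subsetP h1 v vD; have := subsetP h2 v vD; rewrite E !inE.
by case: (v \in A).
Qed.

Lemma boundary_sides_sub (M : {set {set vertex G}}) :
  M \subset sides -> (@boundary G) @: M \subset kcuts G k.
Proof.
move=> sM; apply/subsetP => C /imsetP[A /(subsetP sM)]; rewrite inE => /and3P[A0 AT h] ->.
by rewrite inE cut_in.
Qed.

Lemma minsides_sub : minsides \subset sides.
Proof. by apply/subsetP => A /minsideP. Qed.

Lemma card_minsides : 2 < #|minsides| -> #|minsides| <= #|kcuts G k|.
Proof.
move=> M3; rewrite -(card_in_imset (boundary_minsides_inj M3)).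
exact/subset_leq_card/boundary_sides_sub/minsides_sub.
Qed.

(** * Arcs at the minimal sides *)

(* [mark A] is the indicator of a chosen point of [A]; [spread c] puts [c A] arcs
   on the chosen point of each minimal side [A]. *)
Definition mark A (v : vertex G) : nat := [pick x in A] == Some v.
Definition spread (c : {set vertex G} -> nat) v := \sum_(A in minsides) c A * mark A v.

Lemma sum_mark A B : A != set0 -> A \subset B \/ A \subset ~: B ->
  \sum_(v in B) mark A v = (A \subset B).
Proof.
move=> A0 h; rewrite /mark; case: pickP => [x xA|h0]; last first.
  by case/set0Pn: A0 => v; rewrite h0.
have -> : \sum_(v in B) (Some x == Some v) = \sum_(v in B) (x == v) by [].
rewrite sum_mem1; case: h => [AB|AB].
  by rewrite AB (subsetP AB).
have /negbTE xB : x \notin B by have := subsetP AB x xA; rewrite inE.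
by rewrite xB; case: (boolP (A \subset B)) => // /subsetP/(_ x xA); rewrite xB.
Qed.

(** A minimal side not contained in [B] is disjoint from it, so its chosen point lies outside
    [B]. *)
Lemma sum_spread c B : B \in sides ->
  \sum_(v in B) spread c v = \sum_(A in minsides | A \subset B) c A.
Proof.
move=> sB; rewrite exchange_big /= [RHS]big_mkcondr /=; apply: eq_bigr => A mA.
rewrite -big_distrr /= (sum_mark (sides_neq0 (minsideP mA)) (minside_cases mA sB)).
by case: ifP; rewrite ?muln1 ?muln0.
Qed.

Lemma sum_spreadT c : \sum_v spread c v = \sum_(A in minsides) c A.
Proof.
rewrite exchange_big /=; apply: eq_bigr => A mA.
rewrite -big_distrr /= (eq_bigl (fun v => v \in [set: vertex G])) => [|v]; last by rewrite inE.
have hA := sides_neq0 (minsideP mA).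
by rewrite sum_mark ?subsetT ?muln1 //; left.
Qed.

Lemma sum_spreadZ c B : B \in sides ->
  (\sum_(v in B) (spread c v)%:R = (\sum_(A in minsides | A \subset B) c A)%:R :> 'Z_3)%R.
Proof. by move=> sB; rewrite -natr_sum sum_spread. Qed.

Lemma sub_minside B : B \in minsides ->
  (fun A => (A \in minsides) && (A \subset B)) =1 pred1 B.
Proof.
move=> mB A; apply/andP/eqP => [[mA h]|->]; last by rewrite mB.
exact: (minside_min mB (minsideP mA) h).
Qed.

(** Arcs between z0 and the chosen points repair the sides; every other cut has at least six edges,
    and additional arcs cannot spoil it. *)
Lemma beta_orientation_of_weights (beta : vertex G -> 'Z_3)
    (cp cq : {set vertex G} -> nat) :
  boundary_function beta ->
  up (\sum_(A in minsides) (cp A + cq A))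
     ((\sum_(A in minsides) cq A)%:R - (\sum_(A in minsides) cp A)%:R)%R ->
  (forall A, A != set0 -> A != setT -> A \notin sides -> 5 < #|boundary A|) ->
  (forall B, B \in sides ->
     let w c := \sum_(A in minsides | A \subset B) c A in
     ok (k + (w cp + w cq)) (\sum_(v in B) beta v + ((w cq)%:R - (w cp)%:R))%R) ->
  exists D, beta_orientation beta D.
Proof.
move=> hb hup hbig hok.
apply: (@beta_orientation_of_stubs beta (spread cp) (spread cq)) => //.
  by rewrite big_split /= !sum_spreadT sumrB -!natr_sum !sum_spreadT -big_split.
move=> A A0 AT; case sA: (A \in sides); last first.
  by apply: ok_ge6; apply: leq_trans (leq_addr _ _); apply: hbig; rewrite ?sA.
have := hok A sA; rewrite /= big_split /= !sum_spread // sumrB !sum_spreadZ //.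
by move: (sA); rewrite inE => /and3P[_ _ /eqP ->].
Qed.

End Multigraph.

(** * The two connectivity results *)

Lemma subset_of_card (T : finType) (M : {set T}) n : n <= #|M| ->
  exists2 M1 : {set T}, M1 \subset M & #|M1| = n.
Proof.
move=> nM; exists [set x in take n (enum M)].
  by apply/subsetP => x; rewrite inE => /mem_take; rewrite mem_enum.
rewrite cardsE (card_uniqP _) ?take_uniq ?enum_uniq // size_takel // -cardE.
exact: nM.
Qed.

Lemma sum_mem_card (T : finType) (M N : {set T}) :
  N \subset M -> \sum_(A in M) (A \in N) = #|N|.
Proof.
move=> NM; rewrite -sum1_card [LHS]big_mkcond [RHS]big_mkcond /=.
apply: eq_bigr => A _; case NA: (A \in N); first by rewrite (subsetP NM _ NA).
by case: ifP.
Qed.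

Lemma Z3_connected_5 (G : mgraph) :
  edge_connected G 5 -> #|kcuts G 5| <= 7 -> Z3_connected G.
Proof.
move=> conn c7 beta hb; set M := minsides G 5.
have M7 : #|M| <= 7.
  case M3: (2 < #|M|); first exact: leq_trans (card_minsides (isT : 0 < 5) conn M3) c7.
  by move/negbT: M3; rewrite -leqNgt => /leq_trans; apply.
(* Each minimal side gets one arc, directed to z0 for those in [N]. As [N] has 0, 1 or 2 members,
   six arcs give boundary 1 - 5, nonzero modulo 3, and seven give 2 - 5 = 0, as [up] requires. *)
have [N NM cN] := subset_of_card (leq_subr 5 #|M|).
apply: (@beta_orientation_of_weights G 5 conn beta
          (fun A => A \notin N) (fun A => A \in N)) => //.
- have E : \sum_(A in M) ((A \notin N) + (A \in N)) = #|M|.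
    by rewrite -sum1_card; apply: eq_bigr => A _; case: (A \in N).
  have E2 : \sum_(A in M) (A \notin N) = #|M| - (#|M| - 5).
    by rewrite -[X in X - _]E big_split /= sum_mem_card // cN addnK.
  rewrite -/M E E2 sum_mem_card // cN; move: M7.
  by move: #|M| => m; case: m => [|[|[|[|[|[|[|[|m]]]]]]]].
- by move=> A A0 AT; exact: boundary_gt.
- move=> B sB /=; apply: ok_ge6; rewrite -(addn1 5) leq_add2l -big_split /=.
  have [A mA AB] := minside_exists sB.
  by rewrite (bigD1 A) ?mA //=; case: (A \in N).
Qed.

Lemma Z3_connected_4 (G : mgraph) :
  edge_connected G 4 -> #|kcuts G 4| <= 5 -> kcuts G 5 = set0 -> Z3_connected G.
Proof.
move=> conn c5 no5 beta hb; set M := minsides G 4; set S := sides G 4.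
have big A : A != set0 -> A != setT -> A \notin S -> 5 < #|boundary A|.
  move=> A0 AT /(boundary_gt conn A0 AT); rewrite leq_eqVlt => /orP[/eqP E|//].
  by have := in_set0 (boundary A); rewrite -no5 inE cut_in // -E eqxx.
have MS := @minsides_sub G 4.
case M4: (#|M| <= 3).
  (* Each minimal side gets two arcs. With three minimal sides one of the six arcs is directed to
     z0, giving boundary 1 - 5, nonzero modulo 3. *)
  have [N NM cN] : exists2 N : {set {set vertex G}}, N \subset M & #|N| = (#|M| == 3).
    by apply: subset_of_card; case: #|M| => [|[|[|[|]]]].
  apply: (@beta_orientation_of_weights G 4 conn beta
          (fun A => 1 + (A \notin N)) (fun A => A \in N)) => //.
  - have E : \sum_(A in M) ((1 + (A \notin N)) + (A \in N)) = 2 * #|M|.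
      rewrite -sum1_card big_distrr /=; apply: eq_bigr => A _; by case: (A \in N).
    have E2 : \sum_(A in M) (1 + (A \notin N)) = 2 * #|M| - (#|M| == 3).
      by rewrite -[X in X - _]E [in RHS]big_split /= sum_mem_card // cN addnK.
    rewrite -/M E E2 sum_mem_card // cN; move: M4.
    by move: #|M| => -[|[|[|[|m]]]].
  - move=> B sB /=; apply: ok_ge6; rewrite -(addn2 4) leq_add2l -big_split /=.
    have [A mA AB] := minside_exists sB.
    by rewrite (bigD1 A) ?mA //=; case: (A \in N).
have M3 : 2 < #|M| by move: M4; move: #|M|; clear; lia.
have inj := boundary_minsides_inj (isT : 0 < 4) conn M3.
have M5 : #|M| <= 5 := leq_trans (card_minsides (isT : 0 < 4) conn M3) c5.
(* [X] collects the minimal sides that get a second arc. With at most five arcs at z0 their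
   directions are free, and every non-minimal side must receive two. *)
have [X [XM cX hX]] : exists X : {set {set vertex G}}, [/\ X \subset M, #|M| + #|X| <= 5 &
    forall B, B \in S -> B \notin M -> 2 <= \sum_(A in M | A \subset B) (1 + (A \in X))].
  (* The complement of a minimal side contains all the other minimal sides, of which there are at
     least two. *)
  have compl A (X : {set {set vertex G}}) : A \in M ->
      2 <= \sum_(A' in M | A' \subset ~: A) (1 + (A' \in X)).
    move=> mA; apply: (@leq_trans (\sum_(A' in M :\ A) 1)).
      by rewrite sum1_card; move: M3; rewrite (cardsD1 A M) mA.
    rewrite (eq_bigl (fun A' => (A' \in M) && (A' != A))); last first.
      by move=> A'; rewrite !inE andbC.
    rewrite [X in _ <= X](bigID (fun A' => A' != A)) /=; apply: leq_trans (leq_addr _ _).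
    rewrite [X in _ <= X](eq_bigl (fun A' => (A' \in M) && (A' != A))).
      by apply: leq_sum => A' _; rewrite leq_addr.
    move=> A'; case mA': (A' \in M) => //=; case: (eqVneq A' A) => [->|AA]; first by rewrite andbF.
    by rewrite (minside_disjoint conn mA' mA AA).
  have fromM B (X : {set {set vertex G}}) : B \in S -> B \notin M -> boundary B \in (@boundary G) @: M ->
      2 <= \sum_(A in M | A \subset B) (1 + (A \in X)).
    move=> sB nB /imsetP[A mA /esym E].
    case: (boundary_inj (isT : 0 < 4) conn E) nB => ->; first by rewrite mA.
    by move=> _; exact: compl.
  have [/existsP[B0 /andP[sB0 nB0]]|] := boolP
      [exists B0, (B0 \in S) && (boundary B0 \notin (@boundary G) @: M)]; last first.
    rewrite negb_exists => /forallP h; exists set0; split; rewrite ?sub0set ?cards0 ?addn0 //.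
    move=> B sB nB; apply: fromM => //; have := h B; rewrite sB /=; exact: negbNE.
  (* The minimal sides account for at least four of the at most five 4-cuts, so [boundary B0] is the
     only further one. *)
  have cM : #|M| = 4.
    apply/eqP; rewrite eqn_leq ltnNge M4 andbT -ltnS; apply: leq_trans c5.
    apply: (@leq_trans #|boundary B0 |: (@boundary G) @: M|).
      by rewrite cardsU1 nB0 card_in_imset.
    apply: subset_leq_card; rewrite subUset sub1set (boundary_sides_sub MS) andbT.
    have := boundary_sides_sub (subxx S); move/subsetP; apply; exact: imset_f.
  have only B : B \in S -> boundary B \notin (@boundary G) @: M -> B = B0 \/ B = ~: B0.
    move=> sB nB; apply: (boundary_inj (isT : 0 < 4) conn); apply: contraTeq c5 => BB.
    rewrite -ltnNge; apply: (@leq_trans #|boundary B |: (boundary B0 |: (@boundary G) @: M)|).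
      by rewrite !cardsU1 card_in_imset // cM nB0 !inE negb_or nB eq_sym BB.
    apply: subset_leq_card; rewrite !subUset !sub1set (boundary_sides_sub MS) andbT.
    by have /subsetP h := boundary_sides_sub (subxx S); rewrite !h ?imset_f.
  pose In (B : {set vertex G}) := [set A in M | A \subset B].
  have InS (B : {set vertex G}) (X : {set {set vertex G}}) : \sum_(A in M | A \subset B) (1 + (A \in X)) = #|In B| + #|In B :&: X|.
    rewrite big_split /= sum1dep_card; congr (_ + _).
    rewrite -sum1_card [LHS]big_mkcond [RHS]big_mkcond; apply: eq_bigr => A _; rewrite !inE.
    by case: (_ && _); case: (A \in X).
  have In0 B : B \in S -> 0 < #|In B|.
    move=> sB; have [A mA AB] := minside_exists sB.
    by rewrite card_gt0; apply/set0Pn; exists A; rewrite inE mA AB.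
  have InM B : In B \subset M by apply/subsetP => A; rewrite inE => /andP[].
  have cIn : #|In B0| + #|In (~: B0)| = 4.
    have memIn A B : (A \in In B) = (A \in M) && (A \subset B) by rewrite inE.
    rewrite -cM -cardsUI [X in _ + X](_ : _ = 0) ?addn0.
      apply: eq_card => A; rewrite in_setU !memIn -andb_orr; case mA: (A \in M) => //=.
      by have [->|->] := minside_cases conn mA sB0; rewrite ?orbT.
    apply: eq_card0 => A; rewrite in_setI !memIn.
    apply/negP => /andP[/andP[mA h1] /andP[_ h2]].
    have /set0Pn[v vA] := sides_neq0 (minsideP mA).
    by have := subsetP h2 v vA; rewrite inE (subsetP h1 v vA).
  have fin (X : {set {set vertex G}}) : X \subset M -> #|X| <= 1 -> 2 <= #|In B0| + #|In B0 :&: X| ->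
     2 <= #|In (~: B0)| + #|In (~: B0) :&: X| ->
     exists X : {set {set vertex G}}, [/\ X \subset M, #|M| + #|X| <= 5 &
       forall B, B \in S -> B \notin M -> 2 <= \sum_(A in M | A \subset B) (1 + (A \in X))].
    move=> XM cX h1 h2; exists X; split=> // [|B sB nB].
      by rewrite cM; move: cX; clear; move: #|X|; lia.
    case E: (boundary B \in (@boundary G) @: M); first exact: fromM.
    by rewrite InS; case: (only B sB (negbT E)) => ->.
  (* [B0] and its complement share the four minimal sides as 2 + 2 or 1 + 3; in the second case the
     lone one gets the extra arc. *)
  have := In0 _ sB0; have := In0 _ (sidesC sB0); move: cIn.
  case: (ltngtP #|In B0| 1) => [|h1|h1]; first by case: #|In B0|.
    case: (ltngtP #|In (~: B0)| 1) => [|h2|h2] _; first by case: #|In (~: B0)|.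
      move=> _ _; apply: (fin set0); rewrite ?sub0set ?cards0 //.
        exact: leq_trans h1 (leq_addr _ _).
      exact: leq_trans h2 (leq_addr _ _).
    move=> _ _; apply: (fin (In (~: B0))); rewrite ?InM ?h2 ?setIid ?h2 //.
    exact: leq_trans h1 (leq_addr _ _).
  rewrite h1 => cIn _ _; apply: (fin (In B0)); rewrite ?InM ?setIid ?h1 //.
  by have : #|In (~: B0)| = 3 by [move: cIn; move: #|_|; clear; lia]; move=> ->.
have cqE A : (\sum_(v in A) beta v == 1)%R + (\sum_(v in A) beta v != 1)%R = 1.
  by case: eqP.
(* A minimal side with a single arc has degree five and needs a nonzero boundary: an arc to z0
   changes 1 to 2, an arc from z0 changes 0 to -1 and -1 to -2. *)
apply: (@beta_orientation_of_weights G 4 conn beta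
   (fun A => (\sum_(v in A) beta v != 1)%R + (A \in X))
   (fun A => (\sum_(v in A) beta v == 1)%R : nat)) => //.
- rewrite -/M (eq_bigr (fun A => 1 + (A \in X))) => [|A _]; last first.
    by rewrite addnAC [_ + (_ == _)]addnC cqE.
  by rewrite big_split /= sum1_card sum_mem_card // /up cX.
- move=> B sB /=; case mB: (B \in M).
    rewrite !(eq_bigl _ _ (sub_minside mB)) !big_pred1_eq; case: (B \in X); first by apply: ok_ge6; case: eqP.
    by z3 (\sum_(v in B) beta v)%R.
  apply: ok_ge6; rewrite -(addn2 4) leq_add2l -big_split /=.
  have := hX B sB (negbT mB); congr (_ <= _); apply: eq_bigr => A _.
  by rewrite addnAC [_ + (_ == _)]addnC cqE.
Qed.

Theorem theorem1p4 :
  (forall G : mgraph,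
     edge_connected G 4 -> #|kcuts G 4| <= 5 -> kcuts G 5 = set0 ->
     Z3_connected G)
  /\
  (forall G : mgraph,
     edge_connected G 5 -> #|kcuts G 5| <= 7 ->
     Z3_connected G).
Proof. by split=> G; [exact: Z3_connected_4 | exact: Z3_connected_5]. Qed.
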